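(* Let $V$ be a finite-dimensional real inner product space of dimension $n$ and let $\mathcal{H}$ be a Coxeter arrangement in $V$ with Coxeter group $W$ such that $-\mathrm{id}_V\in W$ and $\mathcal{H}$ is not of type $A_1^n$. (Equivalently, $\mathcal{H}$ is, up to isometry, a Cartesian product of arrangements of types $A_1$, $B_m$ ($m\geq 3$), $D_{2m}$ ($m\geq 2$), $E_7$, $E_8$, $F_4$, $H_3$, $H_4$, $I_2(2k)$ ($k\geq 2$), not all factors being of type $A_1$.) Let $K\subseteq V$ be a convex body (compact convex set) containing the origin such that $K=L+b$ for some $b\in V$ and some set $L$ with $w(L)=L$ for all $w\in W$. Then $P(\mathcal{H},K)=0$.
   Context: Let $V$ be a real inner product space of dimension $n$ with inner product $(\cdot,\cdot)$. A (central) hyperplane arrangement $\mathcal{H}$ in $V$ is given by a finite set $E$ of unit vectors, no two linearly dependent, via $\mathcal{H}=\{H_e:e\in E\}$, $H_e=\{x:(e,x)=0\}$. Chambers are the connected components of $V\setminus\bigcup_e H_e$; there is a base chamber $T_0$ on which $(e,x)>0$ for all $e\in E$, and for a chamber $T$, $(-1)^T=(-1)^s$ where $s$ is the number of $e\in E$ with $T$ and $T_0$ on opposite sides of $H_e$. $\mathrm{Vol}$ denotes Lebesgue measure on $V$. For measurable $K$ of finite volume, $P(\mathcal{H},K)=\sum_T(-1)^T\mathrm{Vol}(K\cap T)$ over all chambers $T$. $\mathcal{H}$ is a Coxeter arrangement if the group $W$ generated by the orthogonal reflections in its hyperplanes is finite and these reflections permute the hyperplanes of $\mathcal{H}$; $W$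 is its Coxeter group. The arrangement is of type $A_1^n$ if it consists of $n=\dim V$ pairwise orthogonal hyperplanes. The product of arrangements $\mathcal{H}_1\subset V_1$, $\mathcal{H}_2\subset V_2$ is the arrangement in the orthogonal sum $V_1\times V_2$ with normal vectors $(E_1\times\{0\})\cup(\{0\}\times E_2)$; the types $A,B,D,E,F,H,I_2(m)$ are the standard types of irreducible finite Coxeter (reflection) arrangements. *)

(* Defs.v *)
From HB Require Import structures.
From mathcomp Require Import all_boot all_order all_algebra finmap.
From mathcomp Require Import all_classical all_reals all_analysis.

Set Implicit Arguments.
Unset Strict Implicit.
Unset Printing Implicit Defensive.

Import Order.TTheory GRing.Theory Num.Theory.
Import numFieldNormedType.Exports.

Local Open Scope classical_set_scope.
Local Open Scope ring_scope.

(* Lebesgue measure on R^n, realized on n-tuples: the n-fold product of the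
   one-dimensional Lebesgue measure, with R^(n+1) identified with R * R^n. *)
Section lebesgue_tuple.
Local Open Scope ereal_scope.
Variable R : realType.

Definition tuple_cons n (p : measurableTypeR R * n.-tuple (measurableTypeR R)) :
  n.+1.-tuple (measurableTypeR R) := [tuple of p.1 :: p.2].

Lemma measurable_tuple_cons n : measurable_fun [set: _] (@tuple_cons n).
Proof. exact: measurable_cons. Qed.

Definition tuple_uncons n (t : n.+1.-tuple (measurableTypeR R)) :
  measurableTypeR R * n.-tuple (measurableTypeR R) :=
  (thead t, [tuple of behead t]).

Lemma measurable_tuple_uncons n : measurable_fun [set: _] (@tuple_uncons n).
Proof.
apply/measurable_fun_pairP; split => /=.
- exact: (measurable_tnth ord0).
- exact: measurable_behead.
Qed.

Lemma tuple_consK n : cancel (@tuple_cons n) (@tuple_uncons n).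
Proof.
by move=> [x t]; congr pair; apply/val_inj.
Qed.

Section step.
Variables (n : nat)
  (mu : {sigma_finite_measure set (n.-tuple (measurableTypeR R)) -> \bar R}).

Definition lebesgue_tupleS : set (n.+1.-tuple (measurableTypeR R)) -> \bar R :=
  pushforward (@lebesgue_measure R \x mu) (@tuple_cons n).

HB.instance Definition _ := Measure.copy lebesgue_tupleS
  (measure_function_pushforward__canonical__measure_function_Measure
     (@lebesgue_measure R \x mu) (@measurable_tuple_cons n)).

Lemma lebesgue_tupleS_sigma_finite : sigma_finite [set: _] lebesgue_tupleS.
Proof.
have /sigma_finiteP[F [TF ndF Foo]] := sigma_finiteT (@lebesgue_measure R).
have /sigma_finiteP[G [TG ndG Goo]] := sigma_finiteT mu.
exists (fun k => @tuple_uncons n @^-1` (F k `*` G k)).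
  rewrite -preimage_bigcup (_ : \bigcup_k (F k `*` G k) = setT)//.
  rewrite -subTset => -[x y] _.
  have [k _ Fkx] : (\bigcup_k F k) x by rewrite -TF.
  have [l _ Gly] : (\bigcup_k G k) y by rewrite -TG.
  exists (maxn k l) => //; split.
  - by move: x Fkx; exact/subsetPset/ndF/leq_maxl.
  - by move: y Gly; exact/subsetPset/ndG/leq_maxr.
move=> k; have [mF Fk] := Foo k; have [mG Gk] := Goo k; split.
  rewrite -[X in measurable X]setTI; apply: measurable_tuple_uncons => //.
  exact: measurableX.
rewrite /lebesgue_tupleS /pushforward -comp_preimage.
rewrite (_ : _ \o _ = id) ?preimage_id; last first.
  by apply/funext => p /=; rewrite tuple_consK.
by rewrite product_measure1E// lte_mul_pinfty// ge0_fin_numE.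
Qed.

HB.instance Definition _ := @Measure_isSigmaFinite.Build _ _ _
  lebesgue_tupleS lebesgue_tupleS_sigma_finite.
End step.

Fixpoint lebesgue_tuple n :
    {sigma_finite_measure set (n.-tuple (measurableTypeR R)) -> \bar R} :=
  if n is m.+1 then lebesgue_tupleS (lebesgue_tuple m) else \d_[tuple].

End lebesgue_tuple.

(* A finite-dimensional real inner product space is modelled by a normed module
   V with a positive definite symmetric bilinear form dot (a {dot _ for theta}
   with theta the identity), whose norm is asked to be the one induced by dot
   where it matters; its dimension is given by an orthonormal basis. *)
Section arrangement.
Variables (R : realType) (V : normedModType R) (dot : {dot V for (@idfun R)}).

Definition hyperplane (e : V) : set V := [set x | dot e x = 0].

Definition arrangement (E : {fset V}) : set (set V) :=
  [set hyperplane e | e in [set` E]].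

Definition arrangement_complement (E : {fset V}) : set V :=
  ~` \bigcup_(H in arrangement E) H.

Definition chambers (E : {fset V}) : set (set V) :=
  [set connected_component (arrangement_complement E) x |
     x in arrangement_complement E].

Definition lin_dep2 (e f : V) :=
  exists a b : R, (a, b) <> (0, 0) /\ a *: e + b *: f = 0.

(* The finite sets E of normals allowed in the definition of an arrangement,
   together with the base chamber T0. *)
Definition is_arrangement (E : {fset V}) (T0 : set V) :=
  [/\ forall e, e \in E -> dot e e = 1,
      forall e f, e \in E -> f \in E -> e != f -> ~ lin_dep2 e f,
      chambers E T0 &
      forall e x, e \in E -> T0 x -> 0 < dot e x].

Definition opposite_sides (e : V) (T T' : set V) :=
  forall x y, T x -> T' y -> dot e x * dot e y < 0.

Definition chamber_sign (E : {fset V}) (T0 T : set V) : R :=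
  (-1) ^+ #|` [fset e in E | `[< opposite_sides e T T0 >]]%fset|.

(* The orthogonal reflection in hyperplane e, for e a unit vector. *)
Definition reflection (e : V) : V -> V := fun x => x - (2 * dot e x) *: e.

Definition is_transformation_group (G : set (V -> V)) :=
  [/\ G idfun,
      forall g h, G g -> G h -> G (g \o h) &
      forall g h, G g -> cancel g h -> cancel h g -> G h].

Definition coxeter_group (E : {fset V}) : set (V -> V) :=
  smallest is_transformation_group [set reflection e | e in [set` E]].

Definition is_coxeter (E : {fset V}) :=
  finite_set (coxeter_group E) /\
  forall e, e \in E ->
    [set reflection e @` H | H in arrangement E] = arrangement E.

Definition orthonormal_basis n (b : 'I_n -> V) :=
  (forall i j, dot (b i) (b j) = (i == j)%:R) /\
  (forall x, exists c : 'I_n -> R, x = \sum_i c i *: b i).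

Definition type_A1n n (E : {fset V}) :=
  #|` E| = n /\ forall e f, e \in E -> f \in E -> e != f -> dot e f = 0.

(* Lebesgue measure on V, transported from R^n by the coordinates in b; for
   orthonormal b it does not depend on b. *)
Definition Vol n (b : 'I_n -> V) (A : set V) : \bar R :=
  lebesgue_tuple R n [set t | A (\sum_i tnth t i *: b i)].

(* P(H, K); extended-real valued, as Vol is infinite on some sets. *)
Definition pizza_quantity n (b : 'I_n -> V) (E : {fset V}) (T0 K : set V) : \bar R :=
  (\sum_(T \in chambers E) (chamber_sign E T0 T)%:E * Vol b (K `&` T))%E.

End arrangement.

(* Main.v *)
(* Let s(x) be the product of the signs of (e, x) over e in E. Up to a null set,
   P(H, K) is the integral of s over K, that is, the integral F(v) of s(x + v)
   over the invariant set L, and v is in L. Follow s along the segment from x to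
   x + v. It jumps when a hyperplane e is crossed, and, since the roots not
   orthogonal to e are exchanged in pairs by the reflection in e, the jump is, up
   to a constant, the sign of the subarrangement of the roots orthogonal to e.
   Iterating this on the subarrangement writes s(x + v) as a sum over sequences
   e_1, ..., e_k of orthogonal roots of the indicator of the event that
   e_k, ..., e_1 are crossed in this order, times the sign at x of the roots
   orthogonal to e_1, ..., e_k.
   For k < n there is such a root (this is where -1 in W is used), so that the term
   is antisymmetric and its integral over L is zero. For k = n the indicator is that
   of a simplex contained in L, whose volume is a constant times the product of
   the |(e_i, v)|. Hence F(v) is a polynomial Q(v) of degree at most n that does
   not depend on L. As Q is antisymmetric, it vanishes on the hyperplanes; there
   are more than n of them unless the type is A_1^n, so Q vanishes on generic
   lines. *)
From HB Require Import structures.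
Require Import Defs.
From mathcomp Require Import all_boot all_order all_algebra finmap.
From mathcomp Require Import all_classical all_reals all_analysis.
From mathcomp Require Import measurable_realfun ring lra.
Set Implicit Arguments.
Unset Strict Implicit.
Unset Printing Implicit Defensive.
Import Order.TTheory GRing.Theory Num.Theory.
Import numFieldNormedType.Exports.
Local Open Scope classical_set_scope.
Local Open Scope ring_scope.

(** * Reflections and root systems *)

(** The argument hinges on uniformity in [L]. The constants of the jumps depend on the root only,
    the volume attached to a complete flag depends on [v] only, and the integrals that feel the
    shape of [L] are antisymmetric. Hence a ball may replace [L] when [Q] is studied. Each jump
    carries the sign of [(e, v)], and these signs turn the absolute values of the volume into a
    polynomial. That a short orthogonal family can be extended rests on the free action of the group
    on points off the hyperplanes, which is derived from simple roots and the exchange condition,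
    group elements being words in reflections. The simplices lie in [L] because scaling one
    coordinate along a root by a factor in [[-1, 1]] is a convex combination of the identity and a
    reflection. Volumes of linear images matter only up to a constant, so the uniqueness of Haar
    measure takes the place of determinants. *)

Section dot_product.
Variables (R : realType) (V : normedModType R) (dot : {dot V for (@idfun R)}).
Implicit Types (a b e u x y z p : V) (c k : R).

Lemma dotC x y : dot x y = dot y x.
Proof. by rewrite (hermC dot) expr0 mul1r. Qed.

Lemma dotDl x y z : dot (x + y) z = dot x z + dot y z.
Proof. exact: linearDl. Qed.

Lemma dotDr z x y : dot z (x + y) = dot z x + dot z y.
Proof. by rewrite dotC dotDl !(dotC z). Qed.

Lemma dotZl k x z : dot (k *: x) z = k * dot x z.
Proof. exact: linearZl. Qed.

Lemma dotZr k z x : dot z (k *: x) = k * dot z x.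
Proof. by rewrite dotC dotZl (dotC z). Qed.

Lemma dotNl x z : dot (- x) z = - dot x z.
Proof. by rewrite -scaleN1r dotZl mulN1r. Qed.

Lemma dotNr z x : dot z (- x) = - dot z x.
Proof. by rewrite dotC dotNl (dotC z). Qed.

Lemma dotBl x y z : dot (x - y) z = dot x z - dot y z.
Proof. by rewrite dotDl dotNl. Qed.

Lemma dotBr z x y : dot z (x - y) = dot z x - dot z y.
Proof. by rewrite dotDr dotNr. Qed.

Lemma dot0l z : dot 0 z = 0.
Proof. by rewrite -(scale0r 0) dotZl mul0r. Qed.

Lemma dot0r z : dot z 0 = 0.
Proof. by rewrite dotC dot0l. Qed.

Lemma dot_suml (I : Type) (r : seq I) (P : pred I) (F : I -> V) z :
  dot (\sum_(i <- r | P i) F i) z = \sum_(i <- r | P i) dot (F i) z.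
Proof.
by apply: (big_morph (fun x => dot x z) (fun x y => dotDl x y z) (dot0l z)).
Qed.

Lemma dot_sumr (I : Type) (r : seq I) (P : pred I) (F : I -> V) z :
  dot z (\sum_(i <- r | P i) F i) = \sum_(i <- r | P i) dot z (F i).
Proof. by rewrite dotC dot_suml; apply: eq_bigr => i _; rewrite dotC. Qed.

Lemma dot_gt0 x : x != 0 -> 0 < dot x x.
Proof.
by move=> x0; case: dot x0 => f [] [] /= H _ _ x0; exact: (H _ x0).
Qed.

Lemma dot_eq0 x : dot x x = 0 -> x = 0.
Proof.
by move=> xx; apply/eqP; apply: contraT => /dot_gt0; rewrite xx ltxx.
Qed.

Lemma dot_ge0 x : 0 <= dot x x.
Proof.
by have [->|/dot_gt0/ltW//] := eqVneq x 0; rewrite dot0l.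
Qed.

Lemma dot_inj x y : (forall z, dot z x = dot z y) -> x = y.
Proof.
move=> xy; apply/eqP; rewrite -subr_eq0; apply/eqP/dot_eq0.
by rewrite dotBr xy subrr.
Qed.

Lemma unit_proportional e f k : dot e e = 1 -> dot f f = 1 -> f = k *: e ->
  f = e \/ f = - e.
Proof.
move=> ee ff fe; move: ff; rewrite fe dotZl dotZr ee mulr1 => kk.
have /eqP : (k - 1) * (k + 1) = 0 by rewrite mulrDr mulr1 mulrBl kk; lra.
rewrite mulf_eq0 => /orP[/eqP k1|/eqP k1].
- by left; rewrite (_ : k = 1) ?scale1r//; lra.
- by right; rewrite (_ : k = -1) ?scaleN1r//; lra.
Qed.

Local Notation refl := (reflection dot).

Lemma dot_reflr e x y : dot x (refl e y) = dot x y - 2 * dot e y * dot x e.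
Proof. by rewrite /reflection dotBr dotZr. Qed.

Lemma dot_refll e x y : dot (refl e x) y = dot x y - 2 * dot e x * dot e y.
Proof. by rewrite dotC dot_reflr dotC (dotC y e). Qed.

Lemma dot_refl_swap e x y : dot x (refl e y) = dot (refl e x) y.
Proof. by rewrite dot_reflr dot_refll (dotC x e); ring. Qed.

Lemma reflK e x : dot e e = 1 -> refl e (refl e x) = x.
Proof.
move=> ee; apply: dot_inj => z.
by rewrite !(dot_reflr, ee) (dotC z e); ring.
Qed.

Lemma refl_isom e x y : dot e e = 1 -> dot (refl e x) (refl e y) = dot x y.
Proof. by move=> ee; rewrite dot_refl_swap reflK. Qed.

Lemma reflD e x y : refl e (x + y) = refl e x + refl e y.
Proof. by apply: dot_inj => z; rewrite !(dot_reflr, dotDr); ring. Qed.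

Lemma reflZ e k x : refl e (k *: x) = k *: refl e x.
Proof. by apply: dot_inj => z; rewrite !(dot_reflr, dotZr); ring. Qed.

Lemma reflN e x : refl e (- x) = - refl e x.
Proof. by rewrite -scaleN1r reflZ scaleN1r. Qed.

Lemma refl_self e : dot e e = 1 -> refl e e = - e.
Proof. by move=> ee; apply: dot_inj => z; rewrite dot_reflr ee dotNr; ring. Qed.

Lemma refl_orth e x : dot e x = 0 -> refl e x = x.
Proof. by rewrite /reflection => ->; rewrite mulr0 scale0r subr0. Qed.

Lemma reflNe e x : refl (- e) x = refl e x.
Proof. by apply: dot_inj => z; rewrite !(dot_reflr, dotNl, dotNr); ring. Qed.

Lemma refl_inv e x : dot e e = 1 -> refl e x = - x ->  x = dot e x *: e.
Proof.
move=> ee /(congr1 (fun y => x - y)); rewrite /reflection opprK => xx.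
apply: (@scalerI _ _ 2); first by rewrite pnatr_eq0.
by rewrite scalerA scaler_nat mulr2n -xx opprB addrC subrK.
Qed.

Fixpoint refl_word (l : seq V) x : V :=
  if l is a :: l' then refl a (refl_word l' x) else x.

Lemma refl_word_cat l1 l2 x :
  refl_word (l1 ++ l2) x = refl_word l1 (refl_word l2 x).
Proof. by elim: l1 => //= a l1 ->. Qed.

Lemma refl_wordN l x : refl_word l (- x) = - refl_word l x.
Proof. by elim: l => //= a l ->; rewrite reflN. Qed.

Lemma refl_wordZ l k x : refl_word l (k *: x) = k *: refl_word l x.
Proof. by elim: l => //= a l ->; rewrite reflZ. Qed.

Lemma refl_wordD l x y : refl_word l (x + y) = refl_word l x + refl_word l y.
Proof. by elim: l => //= a l ->; rewrite reflD. Qed.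

Lemma refl_word_isom l x y : {in l, forall a, dot a a = 1} ->
  dot (refl_word l x) (refl_word l y) = dot x y.
Proof.
elim: l => //= a l IH ul; rewrite refl_isom ?IH//.
  by move=> c cl; apply: ul; rewrite inE cl orbT.
by apply: ul; rewrite mem_head.
Qed.

Lemma refl_word_rev l x : {in l, forall a, dot a a = 1} ->
  refl_word (rev l) (refl_word l x) = x.
Proof.
elim: l => //= a l IH ul; rewrite rev_cons -cats1 refl_word_cat /= reflK.
  by apply: IH => c cl; apply: ul; rewrite inE cl orbT.
by apply: ul; rewrite mem_head.
Qed.

Lemma refl_conj l a x : {in l, forall b, dot b b = 1} ->
  refl_word l (refl a x) = refl (refl_word l a) (refl_word l x).
Proof.
move=> ul; rewrite /reflection refl_wordD refl_wordN refl_wordZ.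
by rewrite refl_word_isom.
Qed.

(** Nonnegative combinations of [D], by recursion on the list so that the coefficient of the head is
    at hand in inductions. *)
Fixpoint cone (D : seq V) x : Prop :=
  if D is d :: D' then exists2 k, 0 <= k & cone D' (x - k *: d) else x = 0.

Lemma cone0 D : cone D 0.
Proof. by elim: D => //= d D IH; exists 0 => //; rewrite scale0r subr0. Qed.

Lemma coneD D x y : cone D x -> cone D y -> cone D (x + y).
Proof.
elim: D x y => [|d D IH] x y /=; first by move=> -> ->; rewrite addr0.
move=> [k k0 Dx] [k' k0' Dy]; exists (k + k'); first exact: addr_ge0.
by rewrite scalerDl opprD addrACA; exact: IH.
Qed.

Lemma coneZ D c x : 0 <= c -> cone D x -> cone D (c *: x).
Proof.
move=> c0; elim: D x => [|d D IH] x /=; first by move=> ->; rewrite scaler0.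
move=> [k k0 Dx]; exists (c * k); first exact: mulr_ge0.
by rewrite -scalerA -scalerBr; exact: IH.
Qed.

Lemma cone_mem D d : d \in D -> cone D d.
Proof.
elim: D => //= a D IH; rewrite inE => /predU1P[->|dD].
  by exists 1 => //; rewrite scale1r subrr; exact: cone0.
by exists 0 => //; rewrite scale0r subr0; exact: IH.
Qed.

Lemma cone_trans D D' x : {in D, forall d, cone D' d} -> cone D x -> cone D' x.
Proof.
elim: D x => [|d D IH] x /= DD'; first by move=> ->; exact: cone0.
move=> [k k0 Dx]; rewrite -(subrK (k *: d) x); apply: coneD.
  by apply: IH Dx => a aD; apply: DD'; rewrite inE aD orbT.
by apply: coneZ => //; apply: DD'; rewrite mem_head.
Qed.

Lemma cone_dot_ge0 D x y : {in D, forall d, 0 <= dot d y} -> cone D x ->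
  0 <= dot x y.
Proof.
elim: D x => [|d D IH] x /= Dp; first by move=> ->; rewrite dot0l.
move=> [k k0 Dx]; rewrite -(subrK (k *: d) x) dotDl addr_ge0//.
  by apply: IH Dx => a aD; apply: Dp; rewrite inE aD orbT.
by rewrite dotZl mulr_ge0// Dp// mem_head.
Qed.

(** Every term of the combination contributes a nonnegative amount to [(x, y)], so all coefficients
    vanish: the cone is pointed. *)
Lemma cone_dot_eq0 D x y : {in D, forall d, 0 < dot d y} -> cone D x ->
  dot x y = 0 -> x = 0.
Proof.
elim: D x => [|d D IH] x //= Dp [k k0 Dx] xy0.
have dD : {in D, forall a, 0 < dot a y}.
  by move=> a aD; apply: Dp; rewrite inE aD orbT.
have d0 : 0 < dot d y by apply: Dp; rewrite mem_head.
have := cone_dot_ge0 (fun a aD => ltW (dD a aD)) Dx.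
rewrite dotBl xy0 dotZl sub0r oppr_ge0 pmulr_lle0// => k0'.
have k00 : k = 0 by apply/le_anti; rewrite k0' k0.
by move: Dx; rewrite k00 scale0r subr0 => /(IH _ dD); exact.
Qed.

End dot_product.

(** * Free action of a reflection group on the points off its hyperplanes *)

Lemma sub_count_lt (T : eqType) (a1 a2 : pred T) (s : seq T) (x : T) :
  subpred a1 a2 -> x \in s -> a2 x -> ~~ a1 x -> (count a1 s < count a2 s)%N.
Proof.
move=> a12 xs a2x a1x; rewrite !(permP (perm_to_rem xs)) /= a2x (negbTE a1x).
by rewrite add0n add1n ltnS sub_count.
Qed.

Section free_action.
Variables (R : realType) (V : normedModType R) (dot : {dot V for (@idfun R)}).
Local Notation refl := (reflection dot).
Local Notation word := (refl_word dot).
Local Notation cone := (@cone R V).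

Section positive_roots.
Variables (P : seq V) (p : V).
Hypothesis P_unit : {in P, forall e, dot e e = 1}.
Hypothesis P_closed : {in P &, forall a c, refl a c \in P \/ - refl a c \in P}.
Hypothesis P_pos : {in P, forall e, 0 < dot e p}.

Lemma pos_root_oppF e : e \in P -> - e \notin P.
Proof.
move=> eP; apply/negP => /P_pos; rewrite dotNl oppr_gt0 => ep.
by have := P_pos eP; rewrite ltNge (ltW ep).
Qed.

Lemma pos_root_proportional e f k : e \in P -> f \in P -> f = k *: e -> f = e.
Proof.
move=> eP fP fe; have [//|fNe] := unit_proportional (P_unit eP) (P_unit fP) fe.
by have := pos_root_oppF eP; rewrite -fNe fP.
Qed.

Let gen (D : seq V) := {subset D <= P} /\ {in P, forall e, cone D e}.

(* If [- refl a c] were positive, [c + (- refl a c)] would be a multiple of [a],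
   and [a] could be removed from the minimal generating set [D]. *)
Lemma simple_refl_pos D a c : gen D ->
    (forall D', gen D' -> (size D <= size D')%N) ->
  a \in D -> c \in P -> c != a -> refl a c \in P.
Proof.
move=> [DP Dgen] Dmin aD cP ca.
have aP := DP _ aD.
case: (P_closed aP cP) => // gP; exfalso.
set g := - _ in gP.
pose D' := rem a D.
have D'P : {subset D' <= P} by move=> x /mem_rem /DP.
have D'pos : {in D', forall d, 0 < dot d p} by move=> d /D'P/P_pos.
have aD'dec x : cone D x -> cone (a :: D') x.
  apply: cone_trans => d dD; have [->|da] := eqVneq d a.
    by apply: cone_mem; rewrite mem_head.
  by apply: cone_mem; have := perm_to_rem aD => /perm_mem/(_ d); rewrite dD => <-.
have [k k0 cD] := aD'dec _ (Dgen _ cP).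
have [k' k'0 gD] := aD'dec _ (Dgen _ gP).
have cgE : (c - k *: a) + (g - k' *: a) = (2 * dot a c - k - k') *: a.
  rewrite /g /reflection; apply: (@dot_inj _ _ dot) => z.
  by rewrite !(dotDr, dotBr, dotNr, dotZr); ring.
have cgD := coneD cD gD.
have [m0|m0] := ltP 0 (2 * dot a c - k - k').
  have aD' : cone D' a.
    have := coneZ (ltW (_ : 0 < (2 * dot a c - k - k')^-1)) cgD.
    by rewrite invr_gt0 cgE scalerA mulVf ?scale1r ?lt0r_neq0//; exact.
  have : gen D'.
    split=> // x xP; have := aD'dec _ (Dgen _ xP).
    apply: cone_trans => d; rewrite inE => /predU1P[->//|]; exact: cone_mem.
  move=> /Dmin; rewrite size_rem//.
  by case: (D) aD => //= ? ? _; rewrite ltnn.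
(* If the multiple of [a] is not positive, two vectors that are nonnegative at [p] have a
   nonpositive sum, so both vanish at [p]; the cone being pointed, [c] is a multiple of [a]. *)
have c0 := cone_dot_ge0 (fun d dD => ltW (D'pos d dD)) cD.
have g0 := cone_dot_ge0 (fun d dD => ltW (D'pos d dD)) gD.
have : dot (c - k *: a + (g - k' *: a)) p <= 0.
  by rewrite cgE dotZl mulr_le0_ge0// ltW// P_pos.
rewrite dotDl => cg0.
have cp0 : dot (c - k *: a) p = 0 by lra.
have /eqP := cone_dot_eq0 D'pos cD cp0.
rewrite subr_eq0 => /eqP /(pos_root_proportional aP cP) ca'.
by rewrite ca' eqxx in ca.
Qed.

(** A generating subset of minimal size serves as the simple roots; the second clause is the key to
    the exchange condition. *)
Lemma simple_system : exists D : seq V, gen D /\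
  forall a c, a \in D -> c \in P -> c != a -> refl a c \in P.
Proof.
have genP : gen P by split=> // e; exact: cone_mem.
have ex : exists n, `[< exists D, gen D /\ size D = n >].
  by exists (size P); apply/asboolP; exists P.
case: (ex_minnP ex) => n /asboolP[D [Dgen sD]] nmin.
exists D; split=> // a c; apply: simple_refl_pos => // D' D'gen.
by rewrite sD; apply: nmin; apply/asboolP; exists D'.
Qed.

Variable D : seq V.
Hypothesis D_sub : {subset D <= P}.
Hypothesis D_gen : {in P, forall e, cone D e}.
Hypothesis D_refl : forall a c, a \in D -> c \in P -> c != a -> refl a c \in P.

Let D_unit : {in D, forall e, dot e e = 1}.
Proof. by move=> e /D_sub /P_unit. Qed.

(** Descent on the height [(e, p)], measured by the number of positive roots of smaller height. Some
    simple [a] has [(a, e) > 0], as otherwise [(e, e) <= 0], and reflecting in it lowers the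
    height. *)
Lemma pos_root_conj_simple e : e \in P ->
  exists l a, [/\ {subset l <= D}, a \in D & e = word l a].
Proof.
have [m] := ubnP (count (fun f => dot f p < dot e p) P).
elim: m e => // m IH e em eP.
have [eD|eD] := boolP (e \in D); first by exists [::], e.
have [a aD ae] : exists2 a, a \in D & 0 < dot a e.
  apply: contrapT => H.
  have : 0 <= dot e (- e).
    apply: cone_dot_ge0 (D_gen eP) => d dD; rewrite dotNr oppr_ge0 leNgt.
    by apply/negP => de; apply: H; exists d.
  by rewrite dotNr P_unit// oppr_ge0 leNgt ltr01.
have eNa : e != a by apply: contraNneq eD => ->.
have aeP := D_refl aD eP eNa.
have lt_ae : dot (refl a e) p < dot e p.
  rewrite dot_refll; have := mulr_gt0 ae (P_pos (D_sub aD)); lra.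
have [|//|l [c [lD cD ec]]] := IH (refl a e).
  rewrite -ltnS; apply: leq_trans em; rewrite ltnS.
  by apply: (sub_count_lt (x := refl a e)) => // [f /lt_trans|]; [exact|rewrite ltxx].
exists (a :: l), c; split=> //=.
  by move=> x; rewrite inE => /predU1P[->//|/lD].
by rewrite -ec reflK// D_unit.
Qed.

Lemma refl_word_simple l : {subset l <= P} ->
  exists2 l', {subset l' <= D} & word l =1 word l'.
Proof.
elim: l => [|e l IH] lP; first by exists [::].
have [|l1 l1D wl1] := IH; first by move=> x xl; apply: lP; rewrite inE xl orbT.
have eP : e \in P by apply: lP; rewrite mem_head.
have [l2 [a [l2D aD eE]]] := pos_root_conj_simple eP.
have l2u : {in l2, forall b, dot b b = 1} by move=> b /l2D; exact: D_unit.
exists (l2 ++ [:: a & rev l2] ++ l1).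
  move=> x; rewrite mem_cat => /orP[/l2D//|].
  rewrite mem_cat => /orP[|/l1D//]; rewrite inE => /predU1P[->//|].
  by rewrite mem_rev => /l2D.
move=> x; rewrite /= wl1 refl_word_cat /= refl_word_cat refl_conj//; congr (reflection _ _ _) => //.
have := @refl_word_rev _ _ dot (rev l2) (word l1 x); rewrite revK => -> // b.
by rewrite mem_rev => /l2u.
Qed.

Definition signed_root e := e \in P \/ - e \in P.

Lemma root_refl a e : a \in P -> signed_root e -> signed_root (refl a e).
Proof.
move=> aP [eP|eP]; rewrite /signed_root; first exact: P_closed.
by have := P_closed aP eP; rewrite reflN opprK; tauto.
Qed.

Lemma root_word l e : {subset l <= P} -> signed_root e -> signed_root (word l e).
Proof.
elim: l => //= a l IH lP re; apply: root_refl; first by apply: lP; rewrite mem_head.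
by apply: IH => // x xl; apply: lP; rewrite inE xl orbT.
Qed.

Lemma root_posE e : signed_root e -> 0 < dot e p -> e \in P.
Proof. by move=> [//|/P_pos]; rewrite dotNl => ? ?; lra. Qed.

Lemma root_negE e : signed_root e -> dot e p <= 0 -> - e \in P.
Proof. by move=> [/P_pos|//]; move=> ? ?; lra. Qed.

(** Apply the letters of [l] to [a] from the right. At some letter [c] the image turns from positive
    to negative; before it the image must be [c], the only positive root that this simple reflection
    makes negative. *)
Lemma exchange l a : {subset l <= D} -> a \in P -> dot (word l a) p < 0 ->
  exists l1 c l2, l = l1 ++ c :: l2 /\ word l2 a = c.
Proof.
elim: l => [_ /P_pos|c l IH lD aP /= lt0] /=; first by move=> ? ?; lra.
have lD' : {subset l <= D} by move=> x xl; apply: lD; rewrite inE xl orbT.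
have cD : c \in D by apply: lD; rewrite mem_head.
have rl : signed_root (word l a) by apply: root_word; [move=> x /lD' /D_sub|left].
have [lp|lp] := ltP 0 (dot (word l a) p).
  have lP := root_posE rl lp.
  exists [::], c, l; split=> //; apply: contrapT => /eqP lc.
  by have /P_pos := D_refl cD lP lc; lra.
have [|//||l1 [c' [l2 [-> l2c]]]] := IH.
- exact: lD'.
- by have /P_pos := root_negE rl lp; rewrite dotNl; lra.
by exists (c :: l1), c', l2.
Qed.

(** If the last letter is [a] and [l] now denotes the word before it, then [(word l a, p) = (a, refl
    a p) = -(a, p) < 0]. The exchange condition finds in [l] a letter that cancels with the final
    [a], and the length drops by two. *)
Lemma simple_word_fixing l : {subset l <= D} -> word l p = p -> word l =1 id.
Proof.
have [m] := ubnP (size l); elim: m l => // m IH l.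
case/lastP: l => [//|l a]; rewrite size_rcons ltnS => lm lD lp.
have lD' : {subset l <= D}.
  by move=> x xl; apply: lD; rewrite mem_rcons inE xl orbT.
have aD : a \in D by apply: lD; rewrite mem_rcons mem_head.
have aP := D_sub aD.
have lu : {in l, forall b, dot b b = 1} by move=> b /lD'; exact: D_unit.
have lt0 : dot (word l a) p < 0.
  rewrite -lp -cats1 refl_word_cat /= refl_word_isom// dot_refl_swap.
  by rewrite refl_self ?P_unit// dotNl oppr_lt0 P_pos.
have [l1 [c [l2 [lE l2c]]]] := exchange lD' aP lt0.
have l12D : {subset l1 ++ l2 <= D}.
  move=> x; rewrite mem_cat => xl; apply: lD'; rewrite lE mem_cat inE.
  by case/orP: xl => ->; rewrite ?orbT.
have l2u : {in l2, forall b, dot b b = 1}.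
  by move=> b bl; apply: lu; rewrite lE mem_cat inE bl !orbT.
have wE : word (rcons l a) =1 word (l1 ++ l2).
  move=> x; rewrite -cats1 lE !refl_word_cat /= -l2c.
  by rewrite -refl_conj// reflK// P_unit.
move=> x; rewrite wE; apply: IH => //; last by rewrite -wE.
apply: leq_trans lm; rewrite lE !size_cat /= addnS.
by rewrite ltnS leqnSn.
Qed.
End positive_roots.

Lemma refl_word_fixing_regular (P : seq V) p l :
    {in P, forall e, dot e e = 1} ->
    {in P &, forall a c, refl a c \in P \/ - refl a c \in P} ->
    {in P, forall e, 0 < dot e p} -> {subset l <= P} ->
  word l p = p -> word l =1 id.
Proof.
move=> Pu Pc Pp lP lp.
have [D [[DP Dgen] Drefl]] := simple_system Pu Pc Pp.
have [l' l'D ll'] := refl_word_simple Pu Pp DP Dgen Drefl lP.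
move=> x; rewrite ll'.
by apply: (simple_word_fixing Pu Pc Pp DP Drefl) => //; rewrite -ll'.
Qed.
End free_action.

(** * Orthogonal families of roots *)

Lemma poly_nonroot (R : numDomainType) (q : {poly R}) :
  q != 0 -> exists t, q.[t] != 0.
Proof.
move=> q0; apply: contrapT => H.
have all0 t : root q t by apply/negPn/negP => qt; apply: H; exists t.
pose s := [seq j%:R : R | j <- iota 0 (size q)].
have us : uniq s by rewrite map_inj_uniq ?iota_uniq//; exact: mulrIn (oner_neq0 _).
have as_ : all (root q) s by apply/allP.
by have := max_poly_roots q0 as_ us; rewrite size_map size_iota ltnn.
Qed.

Section root_chain.
Variables (R : realType) (V : normedModType R) (dot : {dot V for (@idfun R)}).
Local Notation refl := (reflection dot).
Local Notation word := (refl_word dot).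

Definition orthogonal_seq (s : seq V) :=
  uniq s /\ {in s &, forall x y, x != y -> dot x y = 0}.

Lemma orthogonal_seq_cons e s : orthogonal_seq (e :: s) <->
  [/\ e \notin s, orthogonal_seq s & {in s, forall x, dot x e = 0}].
Proof.
split=> [[/= /andP[es us] orth]|[es [us orth] se]].
- split=> //.
    by split=> // x y xs ys; apply: orth; rewrite inE ?xs ?ys orbT.
  move=> x xs; apply: orth; rewrite ?inE ?xs ?orbT ?eqxx//.
  by apply: contraNneq es => <-.
- split; first by rewrite /= es.
  move=> x y; rewrite !inE => /predU1P[->|xs] /predU1P[->|ys].
  + by rewrite eqxx.
  + by rewrite dotC se.
  + by rewrite se.
  + exact: orth.
Qed.

(** Along a curve with coordinates [1, t, t^2, ...] each condition excludes the roots of a nonzero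
    polynomial in [t], and the product of these polynomials has a nonroot. *)
Lemma exists_generic k (c : 'I_k -> V) (s : seq V) :
    {in s, forall a, exists i, dot a (c i) != 0} ->
  exists t : R, {in s, forall a, dot a (\sum_(i < k) t ^+ i *: c i) != 0}.
Proof.
move=> H; pose q a := \sum_(i < k) dot a (c i) *: 'X^i.
have q0 : \prod_(a <- s) q a != 0.
  rewrite prodf_seq_neq0; apply/allP => a as_ /=.
  have [i ai] := H _ as_; apply: contraNneq ai.
  move=> /(congr1 (fun r : {poly R} => r`_i)) qi; apply/eqP; move: qi.
  rewrite coef0 coef_sum (bigD1 i)//= coefZ coefXn eqxx mulr1 big1 ?addr0//.
  by move=> j ji; rewrite coefZ coefXn eq_sym (inj_eq val_inj) (negbTE ji) mulr0.
have [t] := poly_nonroot q0; rewrite horner_prod prodf_seq_neq0 => /allP ht.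
exists t => a /ht /=; rewrite horner_sum dot_sumr; congr (_ != _).
by apply: eq_bigr => i _; rewrite hornerZ hornerXn dotZr mulrC.
Qed.

Lemma refl_word_orth l x : {in l, forall a, dot a x = 0} -> word l x = x.
Proof.
elim: l => //= a l IH lx; rewrite IH ?refl_orth//; first by apply: lx; rewrite mem_head.
by move=> c cl; apply: lx; rewrite inE cl orbT.
Qed.

Lemma refl_word_orthogonal_mem s e : {in s, forall a, dot a a = 1} ->
  orthogonal_seq s -> e \in s -> word s e = - e.
Proof.
elim: s => //= a s IH su /orthogonal_seq_cons[as_ os sa].
have su' : {in s, forall b, dot b b = 1} by move=> b bs; apply: su; rewrite inE bs orbT.
rewrite inE => /predU1P[->|es].
  by rewrite refl_word_orth// refl_self// su// mem_head.
by rewrite IH// reflN refl_orth// dotC sa.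
Qed.

Variables (n : nat) (b : 'I_n -> V).
Hypothesis b_basis : orthonormal_basis dot b.

Lemma basis_expand x : x = \sum_i dot (b i) x *: b i.
Proof.
have [ob sb] := b_basis; have [c xE] := sb x; rewrite {1}xE; apply: eq_bigr => i _.
congr (_ *: _); rewrite xE dot_sumr (bigD1 i)//= dotZr ob eqxx mulr1 big1 ?addr0//.
by move=> j ji; rewrite dotZr ob eq_sym (negbTE ji) mulr0.
Qed.

Lemma dot_basis x y : dot x y = \sum_i dot (b i) x * dot (b i) y.
Proof.
rewrite {1}(basis_expand x) dot_suml; apply: eq_bigr => i _.
by rewrite dotZl.
Qed.

Lemma dot_basis_neq0 x : x != 0 -> exists i, dot x (b i) != 0.
Proof.
move=> x0; apply: contrapT => H; move/negP: x0; apply.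
rewrite (basis_expand x) big1// => i _; apply/eqP; rewrite scaler_eq0.
by apply/orP; left; rewrite dotC; apply/negPn/negP => bi; apply: H; exists i.
Qed.

Lemma exists_orth (s : seq V) : (size s < n)%N ->
  exists2 x, x != 0 & {in s, forall e, dot e x = 0}.
Proof.
move=> sn; pose M := \matrix_(i < n, j < size s) dot (b i) (nth 0 s j).
have : kermx M != 0.
  by rewrite kermx_eq0 /row_free neq_ltn (leq_ltn_trans (rank_leq_col M)).
move=> /rowV0Pn[u /sub_kermxP uM u0].
exists (\sum_i u ord0 i *: b i).
  apply: contraNneq u0 => H; apply/eqP/matrixP => i j; rewrite ord1 mxE.
  have [ob _] := b_basis.
  have := congr1 (dot (b j)) H; rewrite dot0r dot_sumr (bigD1 j)//= dotZr ob eqxx.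
  rewrite mulr1 big1 ?addr0// => k kj.
  by rewrite dotZr ob eq_sym (negbTE kj) mulr0.
move=> e es; pose j := Ordinal (etrans (index_mem e s) es).
have := congr1 (fun A : 'rV_(size s) => A ord0 j) uM.
rewrite !mxE => H; rewrite -[RHS]H dot_sumr; apply: eq_bigr => i _.
by rewrite dotZr mxE /= nth_index// (dotC _ e).
Qed.

(** The square matrix [A] of the frame satisfies [A *m A^T = 1], hence is invertible, and it kills
    the coordinates of the residue [y]. *)
Lemma frame_expand (f : 'I_n -> V) : (forall i j, dot (f i) (f j) = (i == j)%:R) ->
  forall x, x = \sum_i dot (f i) x *: f i.
Proof.
move=> of_ x; apply/eqP; rewrite -subr_eq0; set y := _ - _.
have fy i : dot (f i) y = 0.
  rewrite dotBr dot_sumr (bigD1 i)//= dotZr of_ eqxx mulr1 big1 ?addr0 ?subrr//.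
  by move=> j ji; rewrite dotZr of_ eq_sym (negbTE ji) mulr0.
pose A := \matrix_(i < n, j < n) dot (f i) (b j).
have AA : A *m A^T = 1%:M.
  apply/matrixP => i j; rewrite !mxE -of_ dot_basis; apply: eq_bigr => k _.
  by rewrite !mxE !(dotC _ (b k)).
have Ay : A *m (\col_j dot (b j) y) = 0.
  apply/matrixP => i j; rewrite !mxE -[RHS](fy i) dot_basis; apply: eq_bigr => k _.
  by rewrite !mxE (dotC _ (f i)).
have y0 : \col_j dot (b j) y = 0 by rewrite -[LHS]mul1mx -(mulmx1C AA) -mulmxA Ay mulmx0.
rewrite (basis_expand y) big1// => i _; move/matrixP: y0 => /(_ i ord0).
by rewrite !mxE => ->; rewrite scale0r.
Qed.

(* Otherwise the span of [s] contains a point [p] on no hyperplane. The composite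
   of [-1] and the reflections in [s] fixes [p], hence is the identity since the
   group acts freely on such points; but it is [-1] on the complement of [s]. *)
Lemma orthogonal_extension (E s : seq V) : {in E, forall e, dot e e = 1} ->
    {in E &, forall a c, refl a c \in E \/ - refl a c \in E} ->
    (exists2 l, {subset l <= E} & forall x, word l x = - x) ->
    {subset s <= E} -> orthogonal_seq s -> (size s < n)%N ->
  exists2 e, e \in E & {in s, forall a, dot a e = 0}.
Proof.
move=> Eu Ec [l lE lN] sE os sn; apply: contrapT => H.
have gen : {in E, forall e, exists i : 'I_(size s), dot e (nth 0 s i) != 0}.
  move=> e eE; apply: contrapT => He; apply: H; exists e => // a as_.
  have ia : (index a s < size s)%N by rewrite index_mem.
  apply/eqP/negPn/negP => ae; apply: He; exists (Ordinal ia).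
  by rewrite /= nth_index// dotC.
have [t] := exists_generic gen; set p := (\sum_i _) => Ep.
have su : {in s, forall a, dot a a = 1} by move=> a /sE/Eu.
have wsum (F : 'I_(size s) -> V) : word s (\sum_i F i) = \sum_i word s (F i).
  apply: (big_morph (word s) (fun x y => refl_wordD _ _ x y)).
  by have := refl_wordZ dot s 0 0; rewrite !scale0r.
have sp : word s p = - p.
  rewrite wsum -sumrN; apply: eq_bigr => i _.
  by rewrite refl_wordZ refl_word_orthogonal_mem ?mem_nth// scalerN.
(* The free action is stated for roots positive at [p]. Reorienting the normals does not change the
   reflections. *)
pose pos e := if 0 < dot e p then e else - e.
have wpos w : word w =1 word (map pos w).
  by elim: w => //= a w IH x; rewrite IH /pos; case: ifP => // _; rewrite reflNe.
have posE a e : refl (pos a) e = refl a e.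
  by rewrite /pos; case: ifP => // _; rewrite reflNe.
have pE e : e \in E -> pos e \in [seq pos i | i <- E] by apply: map_f.
have posN e : dot e p != 0 -> pos (- e) = pos e.
  rewrite /pos dotNl oppr_gt0; case: ltgtP => //; by rewrite opprK.
have id_sl : word (s ++ l) =1 id.
  move=> x; rewrite wpos.
  apply: (@refl_word_fixing_regular _ _ dot (map pos E) p).
  - move=> _ /mapP[e eE ->]; rewrite /pos; case: ifP => _; rewrite ?dotNl ?dotNr ?opprK; exact: Eu.
  - have sgn f : f \in E \/ - f \in E -> f \in map pos E \/ - f \in map pos E.
      move=> [fE|fE]; have := pE _ fE; rewrite /pos; case: ifP; rewrite ?opprK; tauto.
    move=> _ _ /mapP[a aE ->] /mapP[c cE ->]; rewrite posE /pos.
    have := sgn _ (Ec _ _ aE cE).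
    by case: ifP => // _; rewrite reflN opprK; tauto.
  - move=> _ /mapP[e eE ->]; rewrite /pos; case: ifP => //.
    by rewrite dotNl oppr_gt0 => /negbT; rewrite -leNgt lt_neqAle Ep.
  - move=> _ /mapP[a asl ->]; apply: pE.
    by move: asl; rewrite mem_cat => /orP[/sE|/lE].
  - by rewrite -wpos refl_word_cat lN refl_wordN sp opprK.
have [x x0 sx] := exists_orth sn.
have := id_sl x; rewrite refl_word_cat lN refl_wordN refl_word_orth// => xx.
case/eqP: x0; apply: (dot_eq0 (dot := dot)).
by have := congr1 (dot x) xx; rewrite dotNr; lra.
Qed.

(** Started from the empty family, it yields [n] orthogonal roots, so that there are at least [n]
    roots, with equality only in type [A_1^n]. *)
Lemma orthogonal_completion (E s : seq V) : {in E, forall e, dot e e = 1} ->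
    {in E &, forall a c, refl a c \in E \/ - refl a c \in E} ->
    (exists2 l, {subset l <= E} & forall x, word l x = - x) ->
    {subset s <= E} -> orthogonal_seq s -> (size s <= n)%N ->
  exists s', [/\ {subset s' <= E}, orthogonal_seq s' & size s' = n].
Proof.
move=> Eu Ec EN; have [m] := ubnP (n - size s)%N; elim: m s => // m IH s sm sE os.
rewrite leq_eqVlt => /predU1P[sn|sn]; first by exists s.
have [e eE se] := orthogonal_extension Eu Ec EN sE os sn.
apply: (IH (e :: s)).
- by rewrite /= -ltnS; apply: leq_trans sm; rewrite ltnS subnS prednK// subn_gt0.
- by move=> x; rewrite inE => /predU1P[->|/sE].
- apply/orthogonal_seq_cons; split=> //; apply/negP => es.
  by have := se _ es; rewrite Eu// => /eqP; rewrite oner_eq0.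
- exact: sn.
Qed.
End root_chain.
(** * Sign changes of an arrangement along a line *)

(** The factors of [x] and [i x] are equal and cancel, so the list is consumed two elements at a
    time. *)
Lemma prod_involution (T : eqType) (R : comNzRingType) (s : seq T) (i : T -> T)
    (g : T -> R) : uniq s -> {in s, forall x, i x \in s} ->
    {in s, forall x, i (i x) = x} -> {in s, forall x, i x != x} ->
    {in s, forall x, g (i x) = g x} -> {in s, forall x, g x * g x = 1} ->
  \prod_(x <- s) g x = 1.
Proof.
have [m] := ubnP (size s); elim: m s => // m IH [_ _|x s]; first by rewrite big_nil.
rewrite /= ltnS => sm us is_ ii ix gi gg.
have xs : x \in x :: s by rewrite mem_head.
have ixs : i x \in s by have := is_ _ xs; rewrite inE (negbTE (ix _ xs)).
have us' : uniq s by case/andP: us.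
rewrite big_cons (big_rem (i x))//= mulrA gi// gg// mul1r.
have sub y : y \in rem (i x) s -> [/\ y \in x :: s, y != x & y != i x].
  rewrite mem_rem_uniq// => /andP[/= yix ys]; split=> //.
    by rewrite inE ys orbT.
  by apply: contraTneq ys => ->; case/andP: us.
apply: IH => [|||y /sub[ys _ _]|y /sub[ys _ _]|y /sub[ys _ _]|y /sub[ys _ _]].
- by rewrite size_rem//; apply: leq_ltn_trans (leq_pred _) sm.
- exact: rem_uniq.
- move=> y /sub[ys yx yix]; rewrite mem_rem_uniq// inE.
  have iyNx : i y != x by apply: contraNneq yix => <-; rewrite ii.
  have := is_ _ ys; rewrite inE (negbTE iyNx) => /= ->; rewrite andbT.
  by apply: contraNneq yx => iyix; rewrite -(ii _ ys) iyix ii.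
- exact: ii.
- exact: ix.
- exact: gi.
- exact: gg.
Qed.

(* The difference of the two products is the sum of the jumps of
   [t |-> \prod_(u <- s) sg (t - u)] at the points of [s] in between. *)
Lemma sum_sign_jump (R : realDomainType) (s : seq R) (t : R) : uniq s ->
    0 < t -> 0 \notin s -> t \notin s ->
  \prod_(r <- s) Num.sg (t - r) = \prod_(r <- s) Num.sg (- r) +
    \sum_(r <- s | 0 < r < t) 2 * \prod_(u <- s | u != r) Num.sg (r - u).
Proof.
move=> us t0 s0 st; have ps := permEl (perm_sort <=%O s).
rewrite -!(perm_big _ ps); under [X in _ + X]eq_bigr do rewrite -(perm_big _ ps).
(* Once the list is sorted, the induction removes its smallest point [m], which contributes the
   factor 1 at every later point. *)
have : sorted <%O (sort <=%O s).
  by rewrite lt_sorted_uniq_le sort_uniq us sort_le_sorted.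
move: s0 st; rewrite -!(perm_mem ps); move: (sort _ _) => {us ps}s.
elim: s => [|m s IH]; first by rewrite !big_nil addr0.
rewrite !inE !negb_or => /andP[m0 s0] /andP[mt st].
move=> /= ms; have /allP mlt := order_path_min lt_trans ms.
have sm : m \notin s by apply/negP => /mlt; rewrite ltxx.
have {}IH := IH s0 st (path_sorted ms).
rewrite !big_cons eqxx /=.
have inner : \sum_(r <- s | 0 < r < t) 2 * \prod_(u <- m :: s | u != r) Num.sg (r - u)
    = \sum_(r <- s | 0 < r < t) 2 * \prod_(u <- s | u != r) Num.sg (r - u).
  rewrite big_seq_cond [RHS]big_seq_cond; apply: eq_bigr => r /andP[rs _].
  congr (_ * _).
  rewrite big_cons; case: eqP => [mr|_ /=]; first by rewrite mr rs in sm.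
  by rewrite gtr0_sg ?mul1r// subr_gt0 mlt.
rewrite inner; have [m0'|m0'] := ltP 0 m => /=; last first.
  have {}m0 : m < 0 by rewrite lt_neqAle eq_sym m0.
  by rewrite gtr0_sg ?subr_gt0 ?(lt_trans m0)// gtr0_sg ?oppr_gt0// !mul1r.
(* The other points lie to the right of both 0 and [m], so the jump at [m] just reverses the initial
   value. *)
have mE : \prod_(u <- s | u != m) Num.sg (m - u) = \prod_(u <- s) Num.sg (- u).
  rewrite big_seq_cond [RHS]big_seq; apply: eq_big => u.
    by case us : (u \in s) => //=; apply: contraNneq sm => <-.
  move=> /andP[/mlt mu _]; rewrite !ltr0_sg// ?subr_lt0// oppr_lt0.
  exact: lt_trans mu.
have [mt'|mt'] := ltP m t.
  rewrite gtr0_sg ?subr_gt0// ltr0_sg ?oppr_lt0// mE IH; ring.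
have {}mt' : t < m by rewrite lt_neqAle mt.
rewrite [X in _ = _ + X]big1_seq ?addr0; last first.
  move=> r /= /andP[/andP[_ rt] /mlt mr]; by have := lt_trans mt' (lt_trans mr rt); rewrite ltxx.
congr (_ * _); first by rewrite !ltr0_sg// ?subr_lt0// oppr_lt0.
apply: eq_big_seq => r /mlt mr; rewrite !ltr0_sg// ?oppr_lt0 ?subr_lt0.
  exact: lt_trans mr.
exact: lt_trans mr.
Qed.

Section signs.
Variables (R : realType) (V : normedModType R) (dot : {dot V for (@idfun R)}).
Local Notation refl := (reflection dot).

Definition root_seq (A : seq V) :=
  [/\ uniq A, {in A, forall e, dot e e = 1}, {in A, forall e, - e \notin A} &
      {in A &, forall a c, refl a c \in A \/ - refl a c \in A}].

Definition orth_roots (A : seq V) (a : V) := [seq f <- A | dot a f == 0].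

Lemma root_seq_orth A a : root_seq A -> root_seq (orth_roots A a).
Proof.
move=> [uA eA nA cA]; split.
- exact: filter_uniq.
- by move=> e; rewrite mem_filter => /andP[_ /eA].
- move=> e; rewrite mem_filter => /andP[_ eA']; rewrite mem_filter negb_and.
  by rewrite (nA e)// orbT.
- move=> e f; rewrite !mem_filter => /andP[/eqP ae eA'] /andP[/eqP af fA].
  have aef : dot a (refl e f) = 0 by rewrite dot_reflr ae af; ring.
  rewrite dotNr aef oppr0 eqxx /=; exact: cA.
Qed.

(** As [Num.sg 0 = 0], it vanishes on the hyperplanes, where the sum over chambers also gives
    nothing. *)
Definition arr_sign (A : seq V) (x : V) : R := \prod_(e <- A) Num.sg (dot e x).

Section one_root.
Variables (A : seq V) (a : V).
Hypothesis (rA : root_seq A) (aA : a \in A).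

(** The reflection in [a] acts on [A] as a signed permutation, [refl a f = eta f *: perm f], since
    [A] never contains a root together with its opposite. *)
Let eta f : R := if refl a f \in A then 1 else -1.
Let perm f := if refl a f \in A then refl a f else - refl a f.

Let permE f : refl a f = eta f *: perm f.
Proof.
by rewrite /eta /perm; case: ifP; rewrite ?scale1r// scaleN1r opprK.
Qed.

Let eta2 f : eta f * eta f = 1.
Proof. by rewrite /eta; case: ifP; rewrite ?mulrNN mulr1. Qed.

Let perm_in f : f \in A -> perm f \in A.
Proof.
have [_ _ _ cA] := rA; move=> fA; rewrite /perm; case: ifP => // nf.
by case: (cA _ _ aA fA) => //; rewrite nf.
Qed.

Let refl_perm f : f \in A -> refl a (perm f) = eta f *: f.
Proof.
have [_ eA _ _] := rA; move=> fA; rewrite /perm /eta.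
by case: ifP => _; rewrite ?reflN reflK ?eA ?scale1r ?scaleN1r.
Qed.

Let eta_perm f : f \in A -> eta (perm f) = eta f.
Proof.
have [_ _ nA _] := rA; move=> fA; rewrite {1}/eta refl_perm// /eta.
by case: (refl a f \in A); rewrite ?scale1r ?fA// scaleN1r (negbTE (nA _ fA)).
Qed.

Let permK f : f \in A -> perm (perm f) = f.
Proof.
move=> fA; have := permE (perm f); rewrite eta_perm// refl_perm//.
move=> /(congr1 (fun x => eta f *: x)); rewrite !scalerA eta2 !scale1r.
by move=> <-.
Qed.

Let perm_neq f : f \in A -> f != a -> dot a f != 0 -> perm f != f.
Proof.
have [_ eA nA _] := rA; move=> fA fa af; apply/eqP => pf.
have := permE f; rewrite pf /eta; case: ifP => _.
  rewrite scale1r => /(congr1 (dot a)); rewrite dot_reflr eA// => aff.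
  by move/eqP: af; apply; lra.
rewrite scaleN1r => /(refl_inv (eA _ aA)) fE.
have [fE'|fE'] := unit_proportional (eA _ aA) (eA _ fA) fE.
  by rewrite fE' eqxx in fa.
by have := nA _ aA; rewrite -fE' fA.
Qed.

(** On these roots the involution [perm] has no fixed point, so products over them cancel in
    pairs. *)
Let others := [seq f <- A | (f != a) && (dot a f != 0)].

Let prod_others (g : V -> R) : {in others, forall f, g (perm f) = g f} ->
  {in others, forall f, g f * g f = 1} -> \prod_(f <- others) g f = 1.
Proof.
have [uA eA nA _] := rA; move=> gp gg; apply: (prod_involution (i := perm)) => //.
- exact: filter_uniq.
- move=> f; rewrite !mem_filter => /andP[/andP[fa af] fA].
  rewrite perm_in// andbT; apply/andP; split.
    apply: contraNneq fa => pa; have := refl_perm fA.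
    rewrite pa refl_self ?eA// /eta; case: ifP => _.
      by rewrite scale1r => aE; have := nA _ aA; rewrite aE fA.
    by rewrite scaleN1r => /oppr_inj ->.
  have : dot a (refl a f) = - dot a f by rewrite dot_reflr eA//; ring.
  rewrite permE dotZr => aE; apply: contraNneq af => pf; apply/eqP.
  by move: aE; rewrite pf mulr0; lra.
- by move=> f; rewrite mem_filter => /andP[_]; exact: permK.
- by move=> f; rewrite mem_filter => /andP[/andP[fa af] fA]; exact: perm_neq.
Qed.

Let prod_split (g : V -> R) : \prod_(f <- A | f != a) g f =
  \prod_(f <- others) g f * \prod_(f <- orth_roots A a) g f.
Proof.
have [uA eA nA _] := rA.
rewrite (bigID (fun f => dot a f != 0))/= !big_filter; congr (_ * _).
apply: eq_bigl => f; rewrite negbK; case: (eqVneq f a) => //= ->.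
by rewrite eA// oner_eq0.
Qed.

Let prod_split1 (g : V -> R) : \prod_(f <- A) g f =
  g a * \prod_(f <- A | f != a) g f.
Proof.
by have [uA _ _ _] := rA; rewrite (bigD1_seq a).
Qed.

(** Each factor picks up [eta f]. These signs are 1 on the roots orthogonal to [a] and cancel in
    pairs on [others]; [a] itself gives -1. *)
Lemma arr_sign_refl x : arr_sign A (refl a x) = - arr_sign A x.
Proof.
have [uA eA nA cA] := rA.
have sE f : Num.sg (dot f (refl a x)) = eta f * Num.sg (dot (perm f) x).
  rewrite dot_refl_swap permE dotZl sgrM /eta.
  by case: ifP => _; rewrite ?sgr1 ?sgrN1.
rewrite /arr_sign; under eq_bigr do rewrite sE.
rewrite big_split /= [X in X * _](_ : _ = -1); last first.
  rewrite prod_split1 prod_split prod_others ?mul1r.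
  - rewrite big1_seq ?mulr1.
      by rewrite /eta refl_self ?eA// (negbTE (nA _ aA)).
    move=> f /=; rewrite mem_filter => /andP[/eqP af fA].
    by rewrite /eta refl_orth// fA.
  - by move=> f; rewrite mem_filter => /andP[_]; exact: eta_perm.
  - by [].
rewrite mulN1r; congr (- _).
rewrite -[LHS](big_map perm xpredT (fun f => Num.sg (dot f x))).
apply: perm_big; apply: uniq_perm => //.
  rewrite map_inj_in_uniq// => f g fA gA pfg.
  by rewrite -(permK fA) pfg permK.
move=> f; apply/idP/idP => [/mapP[g gA ->]|fA]; first exact: perm_in.
by rewrite -(permK fA); apply: map_f; exact: perm_in.
Qed.

(* On the wall of [a], two roots exchanged up to a sign by the reflection in [a]
   contribute that sign, so only the roots orthogonal to [a] matter. *)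
Lemma arr_sign_wall : exists k : R, forall x, dot a x = 0 ->
  {in A, forall f, f != a -> dot f x != 0} ->
  \prod_(f <- A | f != a) Num.sg (dot f x) = k * arr_sign (orth_roots A a) x.
Proof.
have [uA eA nA _] := rA.
pose gen x := dot a x = 0 /\ {in A, forall f, f != a -> dot f x != 0}.
(* The constant is read off at one generic point [y] of the wall; if there is none, the claim is
   vacuous. *)
have [[y [ay gy]]|nogen] := pselect (exists y, gen y); last first.
  by exists 0 => x ax gx; exfalso; apply: nogen; exists x.
exists (\prod_(f <- others) Num.sg (dot f y)) => x ax gx.
rewrite prod_split; congr (_ * _).
have sg2 z : gen z -> {in others, forall f, Num.sg (dot f z) * Num.sg (dot f z) = 1}.
  move=> [az gz] f; rewrite mem_filter => /andP[/andP[fa _] fA].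
  by rewrite -sgrM gtr0_sg// -expr2 exprn_even_gt0//= gz.
have y2 : \prod_(f <- others) Num.sg (dot f y) * \prod_(f <- others) Num.sg (dot f y) = 1.
  by rewrite -big_split big1_seq//= => f fo; exact: sg2 fo.
(* Both products are signs, so it is enough that they multiply to 1. In the joint factor of [perm f]
   the sign [eta f] occurs once at [x] and once at [y], hence squared. *)
suff xy : \prod_(f <- others) Num.sg (dot f x) * \prod_(f <- others) Num.sg (dot f y) = 1.
  by rewrite -[LHS]mulr1 -[X in _ * X = _]y2 mulrA [X in X * _]xy mul1r.
rewrite -big_split /=; apply: prod_others => f fo.
- have fA : f \in A by move: fo; rewrite mem_filter => /andP[].
  have E z : dot a z = 0 -> dot (perm f) z = eta f * dot f z.
    move=> az; have := dot_refl_swap dot a f z; rewrite (permE f) dotZl refl_orth// => fz.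
    by rewrite fz mulrA eta2 mul1r.
  rewrite !E// !sgrM mulrACA -sgrM eta2 sgr1 mul1r//.
- by rewrite mulrACA !sg2// mulr1.
Qed.
End one_root.

(* Meaningful only when [dot e v != 0]; division by [0] gives [0]. *)
Definition crossing_time (v e x : V) := - dot e x / dot e v.

(** The sign of [(e, x + r v)] is that of [(e, v)] times that of [r - crossing_time v e x], which
    reduces to [sum_sign_jump]; [arr_sign_wall] rewrites each jump. It matters later that [k] is
    chosen before [x], [v] and [t]. *)
Lemma arr_sign_crossings A : root_seq A -> exists k : V -> R,
  forall x v t, 0 < t -> {in A, forall e, dot e v != 0} ->
    {in A &, injective (crossing_time v ^~ x)} ->
    {in A, forall e, crossing_time v e x != 0} ->
    {in A, forall e, crossing_time v e x != t} ->
  arr_sign A (x + t *: v) = arr_sign A x +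
    \sum_(e <- A | 0 < crossing_time v e x < t)
      2 * Num.sg (dot e v) * k e * arr_sign (orth_roots A e) (x + crossing_time v e x *: v).
Proof.
move=> rA; have [uA eA nA _] := rA.
have /choice[k kP] : forall a, exists k : R, a \in A -> forall x, dot a x = 0 ->
    {in A, forall f, f != a -> dot f x != 0} ->
    \prod_(f <- A | f != a) Num.sg (dot f x) = k * arr_sign (orth_roots A a) x.
  move=> a; have [aA|aA] := boolP (a \in A); last by exists 0.
  by have [k kP] := arr_sign_wall rA aA; exists k.
exists k => x v t t0 Av inj c0 ct.
have sE e (r : R) : e \in A ->
    Num.sg (dot e (x + r *: v)) = Num.sg (dot e v) * Num.sg (r - crossing_time v e x).
  move=> eA'; rewrite -sgrM; congr Num.sg; rewrite dotDr dotZr /crossing_time.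
  by field; exact: Av.
have s0 e : e \in A -> Num.sg (dot e x) = Num.sg (dot e v) * Num.sg (- crossing_time v e x).
  by move=> eA'; rewrite -[x in LHS]addr0 -(scale0r v) sE// sub0r.
have jump := sum_sign_jump (s := [seq crossing_time v e x | e <- A]) _ t0.
rewrite /arr_sign (eq_big_seq _ (fun e eA => sE e t eA)) (eq_big_seq _ s0) !big_split /=.
have := jump; rewrite !big_map map_inj_in_uniq// => ->//; last 2 first.
- by apply/mapP => -[e eA' e0]; have := c0 _ eA'; rewrite -e0 eqxx.
- by apply/mapP => -[e eA' e0]; have := ct _ eA'; rewrite -e0 eqxx.
rewrite mulrDr; congr (_ + _); rewrite big_distrr /= big_seq_cond [RHS]big_seq_cond.
apply: eq_bigr => e /andP[eA' _].
rewrite -!mulrA; rewrite -kP//.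
- rewrite mulrCA; congr (2 * _); rewrite big_map (bigD1_seq e)//= -mulrA; congr (_ * _).
  rewrite [RHS](_ : _ = \prod_(f <- A | f != e) (Num.sg (dot f v) *
      Num.sg (crossing_time v e x - crossing_time v f x))); last first.
    rewrite big_seq_cond [RHS]big_seq_cond; apply: eq_bigr => f /andP[fA _].
    by rewrite sE.
  rewrite big_split /=; congr (_ * _).
  rewrite big_seq_cond [RHS]big_seq_cond; apply: eq_bigl => f.
  case fA : (f \in A) => //=; congr negb; apply/eqP/eqP => [|->//].
  exact: inj.
- by rewrite dotDr dotZr /crossing_time; field; exact: Av.
- move=> f fA fe; rewrite dotDr dotZr; apply: contraNneq fe => H.
  apply/eqP/inj => //; rewrite /crossing_time; have fv := Av _ fA.
  have -> : dot f x = - (crossing_time v e x * dot f v) by lra.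
  by rewrite opprK mulfK.
Qed.
End signs.
(** * Lebesgue measure and linear maps *)

Section lebesgue_tuple_theory.
Variable R : realType.
Local Open Scope ereal_scope.
Local Notation T n := (n.-tuple (measurableTypeR R)).
Local Notation mu n := (lebesgue_tuple R n).

Lemma measurable_affine (k c : R) :
  measurable_fun [set: measurableTypeR R]
    (fun x : measurableTypeR R => (k * x + c)%R : measurableTypeR R).
Proof.
apply: (@measurable_funD _ (measurableTypeR R) R).
  by apply: measurable_funM => //; exact: measurable_id.
exact: measurable_cst.
Qed.

(** It is enough to compare two measures on half-open intervals; for negative [k] the preimage is
    closed at the other end, hence the two cases. *)
Lemma lebesgue_measure_affine (k c : R) (A : set (measurableTypeR R)) :
  k != 0%R -> measurable A ->
  (`|k|)%:E * lebesgue_measure ((fun x => (k * x + c)%R) @^-1` A) =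
  lebesgue_measure A.
Proof.
move=> k0 mA.
apply/esym.
have mf := measurable_affine k c.
pose m' : {measure set (measurableTypeR R) -> \bar R} :=
  mscale (NngNum (normr_ge0 k))
  (measure_function_pushforward__canonical__measure_function_Measure (@lebesgue_measure R) mf).
rewrite (@lebesgue_measure_unique R m')//.
move=> X /ocitvP[->|[[a b] /= ab ->]]; first by rewrite !measure0.
rewrite /m' /mscale /= /pushforward lebesgue_measure_itv /= lte_fin ab.
have [kp|kn] := ltP 0%R k.
- rewrite [X in lebesgue_measure X](_ : _ = `](a - c) / k, (b - c) / k]%classic)%R; last first.
    apply/seteqP; split=> x /=; rewrite !in_itv /= ltr_pdivrMr// ler_pdivlMr//;
    by move=> /andP[? ?]; apply/andP; split; lra.
  rewrite lebesgue_measure_itv /= lte_fin ltr_pM2r ?invr_gt0// ltrD2r ab.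
  rewrite -EFinD -EFinM; congr (_%:E); rewrite gtr0_norm//; field; exact: lt0r_neq0.
- have {}kn : (k < 0)%R by rewrite lt_neqAle k0.
  rewrite [X in lebesgue_measure X](_ : _ = `[(b - c) / k, (a - c) / k[%classic)%R; last first.
    apply/seteqP; split=> x /=; rewrite !in_itv /= ler_ndivrMr// ltr_ndivlMr//;
    by move=> /andP[? ?]; apply/andP; split; lra.
  rewrite lebesgue_measure_itv /= lte_fin ltr_nM2r ?invr_lt0// ltrD2r ab.
  rewrite -EFinD -EFinM; congr (_%:E); rewrite ltr0_norm//; field; exact: ltr0_neq0.
Qed.

Definition tuple_affine n (k c : 'I_n -> R) (t : T n) : T n :=
  [tuple (k i * tnth t i + c i)%R | i < n].

Lemma measurable_tuple_affine n (k c : 'I_n -> R) :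
  measurable_fun [set: T n] (tuple_affine k c).
Proof.
apply/measurable_fun_tnthP => i.
rewrite (_ : _ \o _ = (fun x : measurableTypeR R =>
    (k i * x + c i)%R : measurableTypeR R) \o (fun t : T n => tnth t i)).
  apply: measurableT_comp; [exact: measurable_affine|exact: measurable_tnth].
by apply/funext => t /=; rewrite tnth_mktuple.
Qed.

(** Induction on the dimension: the left-hand side is a measure that agrees with the product measure
    on rectangles. *)
Lemma lebesgue_tuple_affine n (k c : 'I_n -> R) (A : set (T n)) :
  (forall i, k i != 0%R) -> measurable A ->
  (\prod_(i < n) `|k i|)%:E * mu n (tuple_affine k c @^-1` A) = mu n A.
Proof.
elim: n k c A => [|n IH] k c A k0 mA.
  rewrite big_ord0 mul1e; congr (\d_ _ _) => //.
  by apply/seteqP; split=> t /=; rewrite (tuple0 t) (tuple0 (tuple_affine _ _ _)).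
pose k' i := k (lift ord0 i); pose c' i := c (lift ord0 i).
pose f (p : measurableTypeR R * T n) : measurableTypeR R * T n :=
  ((k ord0 * p.1 + c ord0)%R, tuple_affine k' c' p.2).
have mf : measurable_fun setT f.
  apply/measurable_fun_pairP; split => /=.
    apply: (measurableT_comp (measurable_affine _ _)); exact: measurable_fst.
  apply: (measurableT_comp (measurable_tuple_affine _ _)); exact: measurable_snd.
have p0 : (0 <= \prod_(i < n.+1) `|k i|)%R by exact: prodr_ge0.
pose m' : {measure set (measurableTypeR R * T n) -> \bar R} :=
  mscale (NngNum p0)
  (measure_function_pushforward__canonical__measure_function_Measure
    (@lebesgue_measure R \x mu n) mf).
have m'E X : m' X = (\prod_(i < n.+1) `|k i|)%:E *
    (@lebesgue_measure R \x mu n) (f @^-1` X) by [].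
have mcA : measurable (@tuple_cons R n @^-1` A).
  by rewrite -[X in measurable X]setTI; exact: measurable_tuple_cons.
have setE : @tuple_cons R n @^-1` (tuple_affine k c @^-1` A) =
    f @^-1` (@tuple_cons R n @^-1` A).
  apply/seteqP; suff fE p : tuple_affine k c (tuple_cons p) = tuple_cons (f p).
    by split=> p; rewrite /preimage /= fE.
  apply: eq_from_tnth => i; rewrite tnth_mktuple.
  by have [j ->|->] := unliftP ord0 i; rewrite ?tnthS ?tnth0 // tnth_mktuple.
have muE X : mu n.+1 X = (@lebesgue_measure R \x mu n) (@tuple_cons R n @^-1` X).
  by [].
rewrite !muE setE -m'E; apply/esym; apply: product_measure_unique => //.
move=> A1 A2 mA1 mA2; rewrite m'E big_ord_recl.
rewrite [f @^-1` _](_ : _ = ((fun x => (k ord0 * x + c ord0)%R) @^-1` A1) `*`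
   (tuple_affine k' c' @^-1` A2)); last by [].
have mA1' : measurable ((fun x : measurableTypeR R =>
    (k ord0 * x + c ord0)%R : measurableTypeR R) @^-1` A1).
  by rewrite -[X in measurable X]setTI; exact: measurable_affine.
have mA2' : measurable (tuple_affine k' c' @^-1` A2).
  by rewrite -[X in measurable X]setTI; exact: measurable_tuple_affine.
rewrite [LHS](_ : _ = (`|k ord0| * \prod_(i < n) `|k' i|)%:E *
  (lebesgue_measure ((fun x => (k ord0 * x + c ord0)%R) @^-1` A1) *
   mu n (tuple_affine k' c' @^-1` A2))).
  rewrite EFinM muleACA lebesgue_measure_affine// IH// => i; exact: k0.
congr (_ * _); exact: product_measure1E.
Qed.
End lebesgue_tuple_theory.

(** * Volume under linear bijections, from the uniqueness of Haar measure *)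

Section linear_change_of_variables.
Variable R : realType.
Local Open Scope ereal_scope.
Local Notation T n := (n.-tuple (measurableTypeR R)).
Local Notation mu n := (lebesgue_tuple R n).

Lemma measurable_tuple_rect n (A : 'I_n -> set (measurableTypeR R)) :
  (forall i, measurable (A i)) -> measurable [set t : T n | forall i, A i (tnth t i)].
Proof.
move=> mA.
rewrite (_ : mkset _ = \bigcap_(i in [set: 'I_n]) ((fun t : T n => tnth t i) @^-1` A i)).
  apply: fin_bigcap_measurable => [|i _]; first exact: finite_finset.
  by rewrite -[X in measurable X]setTI; exact: measurable_tnth.
by apply/seteqP; split=> t /= tA i; [move=> _; exact: tA|exact: tA].
Qed.

Definition tuple_box n (r : R) : set (T n) :=
  [set t | forall i, (`|tnth t i| <= r)%R].

Lemma measurable_tuple_box n r : measurable (@tuple_box n r).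
Proof.
rewrite (_ : tuple_box r = [set t : T n | forall i, `[(- r)%R, r]%classic (tnth t i)]).
  apply: (@measurable_tuple_rect n (fun=> `[(- r)%R, r]%classic)) => i.
  exact: measurable_itv.
by apply/seteqP; split=> t /= H i; have := H i; rewrite in_itv /= -ler_norml.
Qed.

Lemma lebesgue_tuple_box n (r : R) : (0 <= r)%R ->
  mu n (tuple_box r) = ((2 * r) ^+ n)%:E.
Proof.
move=> r0; elim: n => [|n IH].
  by rewrite expr0 /= diracE mem_set// => -[].
have muE X : mu n.+1 X = (@lebesgue_measure R \x mu n) (@tuple_cons R n @^-1` X).
  by [].
rewrite muE (_ : _ @^-1` _ = `[(- r)%R, r]%classic `*` tuple_box r); last first.
  apply/seteqP; split=> -[x t] /=.
    move=> H; split => [|i]; first by have := H ord0; rewrite in_itv /= -ler_norml.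
    by have := H (lift ord0 i); rewrite tnthS.
  move=> [+ H] i; rewrite in_itv /= -ler_norml => xr.
  by have [j ->|->] := unliftP ord0 i; rewrite ?tnthS ?tnth0//; exact: H.
transitivity (lebesgue_measure (`[(- r)%R, r]%classic : set (measurableTypeR R)) *
  mu n (tuple_box r)).
  apply: product_measure1E; [exact: measurable_itv|exact: measurable_tuple_box].
rewrite IH lebesgue_measure_itv /= lte_fin exprS EFinM.
have [r1|r1] := ltP (- r)%R r; first by rewrite -EFinD; congr (_%:E * _); ring.
by rewrite (_ : r = 0%R) ?mulr0// ; lra.
Qed.

Section uniqueness.
Variables (n : nat) (f g : T n -> T n).
Hypotheses (mf : measurable_fun [set: T n] f) (mg : measurable_fun [set: T n] g).
Hypotheses (fK : cancel f g) (gK : cancel g f).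
Let tr (u : T n) : T n -> T n := tuple_affine (fun=> 1%R) (tnth u).
Hypothesis fD : forall t u, f (tr u t) = tr (f u) (f t).

(** Translation invariant because [f] is additive and bijective; it is made a sigma-finite measure
    in order to have product measures with [mu]. *)
Definition linear_pushforward : set (T n) -> \bar R := pushforward (mu n) f.

HB.instance Definition _ := Measure.copy linear_pushforward
  (measure_function_pushforward__canonical__measure_function_Measure (mu n) mf).

Lemma linear_pushforward_sigma_finite : sigma_finite [set: _] linear_pushforward.
Proof.
have [F TF Foo] := sigma_finiteT (mu n).
exists (fun k => g @^-1` F k).
  by rewrite -preimage_bigcup -TF.
move=> k; have [mF Fk] := Foo k; split.
  by rewrite -[X in measurable X]setTI; exact: mg.
rewrite /linear_pushforward /pushforward -comp_preimage.
by rewrite (_ : g \o f = id) ?preimage_id//; apply/funext => x /=; rewrite fK.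
Qed.

HB.instance Definition _ := @Measure_isSigmaFinite.Build _ _ _
  linear_pushforward linear_pushforward_sigma_finite.

Local Notation nu := linear_pushforward.

Let measurable_pre (h : T n -> T n) (A : set (T n)) :
  measurable_fun [set: T n] h -> measurable A -> measurable (h @^-1` A).
Proof. by move=> mh mA; rewrite -[X in measurable X]setTI; exact: mh. Qed.

Let mu_affine k (c : T n) (A : set (T n)) : (`|k| = 1)%R -> measurable A ->
  mu n (tuple_affine (fun=> k) (tnth c) @^-1` A) = mu n A.
Proof.
move=> k1 mA; rewrite -[RHS](@lebesgue_tuple_affine _ _ (fun=> k) (tnth c))//.
  by rewrite big1 ?mul1e.
by move=> _; rewrite -normr_gt0 k1.
Qed.

Let trC x y : tr x y = tr y x.
Proof. by apply: eq_from_tnth => i; rewrite !tnth_mktuple !mul1r addrC. Qed.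

Let nu_tr u A : measurable A -> nu (tr u @^-1` A) = nu A.
Proof.
move=> mA; rewrite /nu /pushforward.
rewrite (_ : f @^-1` _ = tr (g u) @^-1` (f @^-1` A)).
  apply: mu_affine; [exact: normr1|exact: measurable_pre].
by apply/seteqP; split => t; rewrite /preimage /= fD gK.
Qed.

Let measurable_add k : measurable_fun [set: T n * T n]
  (fun p => tuple_affine (fun=> k) (tnth p.1) p.2).
Proof.
apply/measurable_fun_tnthP => i.
rewrite (_ : _ \o _ = fun p : T n * T n =>
    (k * tnth p.2 i + tnth p.1 i)%R : measurableTypeR R); last first.
  by apply/funext => p /=; rewrite tnth_mktuple.
apply: (@measurable_funD _ _ R).
  apply: measurable_funM; first exact: measurable_cst.
  by apply: (measurableT_comp (measurable_tnth i)); exact: measurable_snd.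
by apply: (measurableT_comp (measurable_tnth i)); exact: measurable_fst.
Qed.

Let measurable_graph k (S C : set (T n)) : measurable S -> measurable C ->
  measurable [set p : T n * T n | S p.1 /\ C (tuple_affine (fun=> k) (tnth p.1) p.2)].
Proof.
move=> mS mC; apply: (@measurableI _ _ (fst @^-1` S)).
  by rewrite -[X in measurable X]setTI; exact: measurable_fst.
by rewrite -[X in measurable X]setTI; exact: (measurable_add k).
Qed.

(** The section over [x] in [S] is the preimage of [C] under [y |-> k y + x], which preserves [mu].
    The value [k = -1] serves for the other order of integration. *)
Let graph1 k (S C : set (T n)) : (`|k| = 1)%R -> measurable S -> measurable C ->
  (nu \x mu n) [set p : T n * T n | S p.1 /\ C (tuple_affine (fun=> k) (tnth p.1) p.2)] =
  nu S * mu n C.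
Proof.
move=> k1 mS mC; rewrite /product_measure1 /=.
under eq_integral => x _.
  rewrite (_ : xsection _ x =
    if x \in S then tuple_affine (fun=> k) (tnth x) @^-1` C else set0); last first.
    apply/seteqP; split=> y; rewrite /xsection /= in_setE /=; case: ifPn => xS //=.
    - by case.
    - by move=> -[/mem_set]; rewrite (negbTE xS).
    - by move=> Cy; split=> //; rewrite inE in xS.
  rewrite (_ : mu n _ = (\1_S x)%:E * mu n C); last first.
    rewrite indicE; case: ifPn => xS; last by rewrite measure0 mul0e.
    by rewrite mul1e mu_affine.
  over.
rewrite ge0_integralZr//; first by rewrite integral_indic// setIT.
by apply/measurable_EFinP; exact: measurable_indic.
Qed.

(* Uniqueness of the Haar measure: compute the product measure of
   [{(x, y) | S x /\ C (x + y)}] in both orders of integration. *)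
Lemma linear_pushforward_unique S C : measurable S -> measurable C ->
  nu S * mu n C = nu C * mu n S.
Proof.
move=> mS mC.
have swap X : measurable X -> (nu \x mu n) X = (nu \x^ mu n) X.
  by move=> mX; apply: product_measure_unique => // A B mA mB; exact: product_measure2E.
rewrite -(@graph1 1%R)//; last exact: normr1.
rewrite -(@graph1 (-1)%R)//; last by rewrite normrN normr1.
rewrite !swap; [|exact: measurable_graph..].
(* The sections of the two graphs over [y] differ by the translation by [y], which preserves
   [nu]. *)
rewrite /product_measure2; apply: eq_integral => y _ /=.
set H := (X in ysection X y); set H' := (X in _ = nu (ysection X y)).
rewrite -[RHS](nu_tr y); last exact: measurable_ysection (measurable_graph _ _ _).
congr (nu _); apply/seteqP; split=> x; rewrite /ysection /preimage /= !in_setE /H /H' /=.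
  rewrite -/(tr x y) trC => -[Sx Cx]; split=> //.
  rewrite (_ : tuple_affine _ _ _ = x)//.
  by apply: eq_from_tnth => i; rewrite !tnth_mktuple; ring.
move=> [Cx Sx]; split; last by rewrite -/(tr x y) trC.
move: Sx; rewrite (_ : tuple_affine _ _ _ = x)//.
by apply: eq_from_tnth => i; rewrite !tnth_mktuple; ring.
Qed.
End uniqueness.

(** The constant is the measure of the preimage of the unit cube [C]; it is positive and finite
    because the constants of [f] and of its inverse multiply to 1. *)
Lemma lebesgue_tuple_linear_constant n (f g : T n -> T n) :
    measurable_fun [set: T n] f -> measurable_fun [set: T n] g ->
    cancel f g -> cancel g f ->
    (forall t u, f (tuple_affine (fun=> 1%R) (tnth u) t) =
                 tuple_affine (fun=> 1%R) (tnth (f u)) (f t)) ->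
  exists2 k : R, (0 < k)%R &
    forall A, measurable A -> mu n (f @^-1` A) = k%:E * mu n A.
Proof.
move=> mf mg fK gK fD.
have gD t u : g (tuple_affine (fun=> 1%R) (tnth u) t) =
    tuple_affine (fun=> 1%R) (tnth (g u)) (g t).
  by rewrite -{1}(gK u) -{1}(gK t) -fD fK.
pose C := @tuple_box n (2^-1).
have mC : measurable C by exact: measurable_tuple_box.
have C1 : mu n C = 1.
  by rewrite lebesgue_tuple_box// mulfV ?expr1n// pnatr_eq0.
have fE A : measurable A -> mu n (f @^-1` A) = mu n (f @^-1` C) * mu n A.
  by move=> mA; rewrite -(linear_pushforward_unique mf mg fK gK fD mA mC) C1 mule1.
have gE A : measurable A -> mu n (g @^-1` A) = mu n (g @^-1` C) * mu n A.
  by move=> mA; rewrite -(linear_pushforward_unique mg mf gK fK gD mA mC) C1 mule1.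
have mgC : measurable (g @^-1` C) by rewrite -[X in measurable X]setTI; exact: mg.
have := fE _ mgC; rewrite -comp_preimage (_ : g \o f = id); last first.
  by apply/funext => x /=; rewrite fK.
rewrite preimage_id C1.
have : 0 <= mu n (f @^-1` C) by exact: measure_ge0.
have : 0 <= mu n (g @^-1` C) by exact: measure_ge0.
move: (mu n (g @^-1` C)) (mu n (f @^-1` C)) fE => b a fE b0 a0 ab.
have a_gt0 : 0 < a.
  rewrite lt_neqAle a0 andbT; apply/eqP => aE.
  by move: ab; rewrite -aE mul0e => /eqP; rewrite onee_eq0.
have b_gt0 : 0 < b.
  rewrite lt_neqAle b0 andbT; apply/eqP => bE.
  by move: ab; rewrite -bE mule0 => /eqP; rewrite onee_eq0.
case: a a_gt0 ab fE {a0} => [a| |] a0 ab fE; last by [].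
  by exists a => //; rewrite lte_fin in a0.
by move: ab; rewrite gt0_mulye.
Qed.
End linear_change_of_variables.

(** * Volume on [V] through orthonormal coordinates *)

Section coordinates.
Variables (R : realType) (V : normedModType R) (dot : {dot V for (@idfun R)}).
Hypothesis norm_dot : forall x : V, `|x| ^+ 2 = dot x x.
Variables (n : nat) (b : 'I_n -> V).
Hypothesis b_basis : orthonormal_basis dot b.
Local Notation T := (n.-tuple (measurableTypeR R)).
Local Notation mu := (lebesgue_tuple R n).

Definition vec (t : T) : V := \sum_i tnth t i *: b i.

Definition crd (x : V) : T := [tuple dot (b i) x | i < n].

Lemma dot_vec i t : dot (b i) (vec t) = tnth t i.
Proof.
have [ob _] := b_basis; rewrite /vec dot_sumr (bigD1 i)//= dotZr ob eqxx mulr1.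
by rewrite big1 ?addr0// => j ji; rewrite dotZr ob eq_sym (negbTE ji) mulr0.
Qed.

Lemma crdK x : vec (crd x) = x.
Proof.
rewrite [RHS](basis_expand b_basis); apply: eq_bigr => i _.
by rewrite tnth_mktuple.
Qed.

Lemma vecK t : crd (vec t) = t.
Proof. by apply: eq_from_tnth => i; rewrite tnth_mktuple dot_vec. Qed.

Lemma vec_translate x t : vec (tuple_affine (fun=> 1) (tnth (crd x)) t) = vec t + x.
Proof.
rewrite -[X in _ + X]crdK /vec -big_split; apply: eq_bigr => i _ /=.
by rewrite [X in X *: _]tnth_mktuple mul1r scalerDl.
Qed.

Lemma measurable_dot_vec a : measurable_fun [set: T] (fun t => dot a (vec t)).
Proof.
rewrite (_ : (fun t => _) = fun t : T => \sum_(i <- enum 'I_n) (tnth t i : R) * dot a (b i)).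
  apply: measurable_sum => i; apply: measurable_funM; last exact: measurable_cst.
  exact: measurable_tnth.
apply/funext => t; rewrite /vec dot_sumr big_enum; apply: eq_bigr => i _.
by rewrite dotZr.
Qed.

Lemma measurable_crd_linear (phi : V -> V) : {morph phi : x y / x + y} ->
  (forall k x, phi (k *: x) = k *: phi x) ->
  measurable_fun [set: T] (fun t => crd (phi (vec t))).
Proof.
move=> phiD phiZ; apply/measurable_fun_tnthP => i.
rewrite (_ : _ \o _ = fun t : T =>
    \sum_(j <- enum 'I_n) (tnth t j : R) * dot (b i) (phi (b j)) : measurableTypeR R).
  apply: (@measurable_sum _ _ R) => j; apply: (@measurable_funM _ _ R); last exact: measurable_cst.
  exact: measurable_tnth.
apply/funext => t /=; rewrite tnth_mktuple /vec.
have phi0 : phi 0 = 0 by have := phiZ 0 0; rewrite !scale0r.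
rewrite (big_morph phi phiD phi0) dot_sumr big_enum; apply: eq_bigr => j _.
by rewrite phiZ dotZr.
Qed.

Lemma volume_linear (phi psi : V -> V) : {morph phi : x y / x + y} ->
    (forall k x, phi (k *: x) = k *: phi x) -> {morph psi : x y / x + y} ->
    (forall k x, psi (k *: x) = k *: psi x) -> cancel phi psi -> cancel psi phi ->
  exists2 k : R, 0 < k & forall A : set V, measurable (vec @^-1` A) ->
    mu (vec @^-1` (phi @^-1` A)) = (k%:E * mu (vec @^-1` A))%E.
Proof.
move=> phiD phiZ psiD psiZ phiK psiK.
have mf := measurable_crd_linear phiD phiZ.
have mg := measurable_crd_linear psiD psiZ.
have fK : cancel (fun t => crd (phi (vec t))) (fun t => crd (psi (vec t))).
  by move=> t; rewrite crdK phiK vecK.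
have gK : cancel (fun t => crd (psi (vec t))) (fun t => crd (phi (vec t))).
  by move=> t; rewrite crdK psiK vecK.
have [|k k0 kP] := lebesgue_tuple_linear_constant mf mg fK gK.
  move=> t u; rewrite -{1}[u]vecK vec_translate phiD.
  by rewrite -[LHS]vecK -[RHS]vecK; congr crd; rewrite vec_translate !crdK.
exists k => // A mA; rewrite -kP//; congr (mu _).
by apply/seteqP; split=> t; rewrite /preimage /= crdK.
Qed.

Lemma vec_box_preimage (r : R) : vec @^-1` [set x | forall i, `|dot (b i) x| <= r] = tuple_box r.
Proof.
by apply/seteqP; split=> t /= H i; have := H i; rewrite dot_vec.
Qed.

(** Applying the map twice to a box shows that the positive scaling constant has square 1. *)
Lemma volume_involution (phi : V -> V) : {morph phi : x y / x + y} ->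
    (forall k x, phi (k *: x) = k *: phi x) -> involutive phi ->
  forall A : set V, measurable (vec @^-1` A) ->
    mu (vec @^-1` (phi @^-1` A)) = mu (vec @^-1` A).
Proof.
move=> phiD phiZ phiK.
have [k k0 kP] := volume_linear phiD phiZ phiD phiZ phiK phiK.
suff k1 : k = 1 by move=> A mA; rewrite kP// k1 mul1e.
pose C := [set x | forall i, `|dot (b i) x| <= 2^-1].
have mC : measurable (vec @^-1` C) by rewrite vec_box_preimage; exact: measurable_tuple_box.
have C1 : mu (vec @^-1` C) = 1%E.
  by rewrite vec_box_preimage lebesgue_tuple_box// mulfV ?expr1n// pnatr_eq0.
have mpC : measurable (vec @^-1` (phi @^-1` C)).
  rewrite (_ : _ @^-1` _ = (fun t => crd (phi (vec t))) @^-1` (vec @^-1` C)).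
    by rewrite -[X in measurable X]setTI; exact: measurable_crd_linear.
  by apply/seteqP; split=> t; rewrite /preimage /= crdK.
have := kP _ mpC; rewrite (kP C)// C1 mule1 -EFinM.
rewrite (_ : phi @^-1` (phi @^-1` C) = C); last first.
  by apply/seteqP; split=> x; rewrite /preimage /= phiK.
rewrite C1 => -[kk].
have /eqP : (k - 1) * (k + 1) = 0 by rewrite mulrDr mulrBl -kk; ring.
by rewrite mulf_eq0 => /orP[/eqP|/eqP]; lra.
Qed.

Lemma volume_translate x (A : set V) : measurable (vec @^-1` A) ->
  mu (vec @^-1` [set y | A (y + x)]) = mu (vec @^-1` A).
Proof.
move=> mA; rewrite -[RHS](@lebesgue_tuple_affine _ _ (fun=> 1) (tnth (crd x)))//.
  rewrite big1 ?mul1e; last by move=> i _; rewrite normr1.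
by congr (mu _); apply/seteqP; split=> t; rewrite /preimage /= vec_translate.
Qed.

(* The graph of [dot a] is null, and its sections are translates of each other. *)
Lemma volume_hyperplane0 a c : a != 0 -> mu (vec @^-1` [set x | dot a x = c]) = 0%E.
Proof.
move=> a0.
pose h t := dot a (vec t).
have mh : measurable_fun [set: T] h := @measurable_dot_vec a.
pose G := [set p : T * measurableTypeR R | h p.1 = p.2].
have mG : measurable G.
  have mE : measurable_fun setT (fun p : T * measurableTypeR R => h p.1 == (p.2 : R)).
    apply: measurable_fun_eqr; last exact: measurable_snd.
    by apply: (measurableT_comp mh); exact: measurable_fst.
  rewrite (_ : G = setT `&` (fun p : T * measurableTypeR R => h p.1 == (p.2 : R)) @^-1` [set true]).
    exact: mE.
  apply/seteqP; split=> p; rewrite /G /=; first by move=> /eqP.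
  by move=> [_ /eqP].
have aa : dot a a != 0 by rewrite lt0r_neq0// dot_gt0.
have G2 : (mu \x^ @lebesgue_measure R)%E G = (mu (vec @^-1` [set x | dot a x = c]) * +oo)%E.
  rewrite /product_measure2 /=.
  under eq_integral => s _.
    rewrite (_ : mu _ = mu (vec @^-1` [set x | dot a x = c])); last first.
      rewrite -[LHS](_ : mu (vec @^-1` [set x | dot a x = s]) = _); last first.
        congr (mu _); apply/seteqP; split=> t; rewrite /ysection /= in_setE //.
      rewrite -(@volume_translate (((s - c) / dot a a) *: a) [set x | dot a x = s]); last first.
        rewrite (_ : _ @^-1` _ = ysection G s); first exact: measurable_ysection.
        by apply/seteqP; split=> t; rewrite /ysection /= in_setE.
      congr (mu _); apply/seteqP; split=> t /=; rewrite dotDr dotZr divfK//; lra.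
    over.
  rewrite integral_cst//; congr (_ * _)%E.
  have : lebesgue_measure [set: R] = +oo%E by rewrite -set_itvNyy lebesgue_measure_itv.
  exact.
have G1 : (mu \x @lebesgue_measure R)%E G = 0%E.
  rewrite /product_measure1 /= integral0_eq// => t _ /=.
  rewrite (_ : xsection _ _ = [set h t]) ?lebesgue_measure_set1//.
  by apply/seteqP; split=> s; rewrite /xsection /= in_setE.
have : (mu \x @lebesgue_measure R)%E G = (mu \x^ @lebesgue_measure R)%E G.
  by apply: product_measure_unique => // A B mA mB; exact: product_measure2E.
rewrite G1 G2 => H; apply/eqP; apply: contraT => m0.
have : (0 < mu (vec @^-1` [set x | dot a x = c]))%E by rewrite lt0e m0 measure_ge0.
by move=> /gt0_muley moo; have := ltry (0 : R); rewrite [X in (X < _)%E]H moo ltxx.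
Qed.

Lemma norm_dot_basis i x : `|dot (b i) x| <= `|x|.
Proof.
rewrite -(@ler_pXn2r _ 2)// ?nnegrE//.
rewrite norm_dot (dot_basis b_basis x x) (bigD1 i)//= real_normK ?num_real//.
by rewrite -expr2 lerDl sumr_ge0// => j _; rewrite -expr2 sqr_ge0.
Qed.

Lemma norm_basis i : `|b i| = 1.
Proof.
have [ob _] := b_basis; have := norm_dot (b i); rewrite ob eqxx => /eqP.
by rewrite sqrf_eq1 => /orP[/eqP//|/eqP bi]; have := normr_ge0 (b i); rewrite bi; lra.
Qed.

Lemma volume_bounded_fin (A : set V) (r : R) : measurable (vec @^-1` A) ->
  (forall x, A x -> `|x| <= r) -> (mu (vec @^-1` A) < +oo)%E.
Proof.
move=> mA Ar; apply: (@le_lt_trans _ _ (mu (tuple_box (Num.max r 0)))).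
  apply: le_measure; rewrite ?inE//; first exact: measurable_tuple_box.
  move=> t /= /Ar tr i; rewrite le_max; apply/orP; left.
  by rewrite -dot_vec (le_trans (norm_dot_basis _ _)).
by rewrite lebesgue_tuple_box ?ltry// le_max lexx orbT.
Qed.

(** The sigma-algebra on tuples is the product one while [U] is open for the norm of [V], so [U] is
    exhausted by the countably many rational boxes inside it. *)
Lemma measurable_vec_open (U : set V) : open U -> measurable (vec @^-1` U).
Proof.
move=> oU.
pose B (q : {ffun 'I_n -> rat} * nat) : set T :=
  [set t | forall i, `|tnth t i - ratr (q.1 i)| < q.2.+1%:R^-1].
pose F q := if `[< B q `<=` vec @^-1` U >] then B q else set0.
rewrite (_ : _ @^-1` _ = \bigcup_q F q).
  apply: countable_bigcupT_measurable => [|q]; first exact: countableP.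
  rewrite /F; case: ifP => // _.
  rewrite (_ : B q = [set t : T | forall i,
    (ball (ratr (q.1 i) : R) q.2.+1%:R^-1 : set (measurableTypeR R)) (tnth t i)]).
    apply: (@measurable_tuple_rect R n (fun i => ball (ratr (q.1 i) : R) q.2.+1%:R^-1)) => i.
    exact: measurable_ball.
  by apply/seteqP; split=> t H i; have := H i; rewrite /ball /= distrC.
apply/seteqP; split=> [t Ut|t [q _]]; last first.
  by rewrite /F; case: ifPn => // /asboolP; exact.
have /nbhs_ballP[e /= e0 eU] : nbhs (vec t) U by apply: open_nbhs_nbhs.
(* Two points of a box differ by at most [2 / (k + 1)] in each of the [n] coordinates, and the basis
   vectors have norm 1. *)
have [k kP] : exists k : nat, n%:R * 2 * k.+1%:R^-1 < e :> R.
  exists (Num.truncn (n%:R * 2 / e)).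
  by rewrite ltr_pdivrMr// [X in _ < X]mulrC -ltr_pdivrMr//; exact: truncnS_gt.
have k0 : 0 < k.+1%:R^-1 :> R by rewrite invr_gt0.
have /choice[q qP] : forall i, exists q : rat, `|tnth t i - ratr q| < k.+1%:R^-1.
  move=> i; have tk : (tnth t i : R) - k.+1%:R^-1 < tnth t i by rewrite ltrBlDr ltrDl.
  have [q] := rat_in_itvoo tk.
  rewrite in_itv /= => /andP[q1 q2]; exists q.
  by rewrite gtr0_norm ?subr_gt0// ltrBlDr -ltrBlDl.
exists ([ffun i => q i], k) => //; rewrite /F.
have tB : B ([ffun i => q i], k) t by move=> i; rewrite ffunE.
case: asboolP => // -[] s sB; apply: eU; rewrite -ball_normE /=.
rewrite /vec -sumrB; apply: le_lt_trans kP.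
apply: (le_trans (ler_norm_sum _ _ _)).
rewrite (_ : n%:R * 2 * k.+1%:R^-1 = \sum_(i < n) 2 * k.+1%:R^-1 :> R); last first.
  by rewrite sumr_const card_ord -mulrA mulr_natl.
apply: ler_sum => i _; rewrite -scalerBl normrZ norm_basis mulr1.
have := tB i; have := sB i; rewrite !ffunE /= => /ltW H1 /ltW H2.
rewrite (le_trans (ler_distD (ratr (q i)) _ _))// mulrDl mul1r lerD//.
by rewrite distrC.
Qed.

Lemma measurable_vec_closed (A : set V) : closed A -> measurable (vec @^-1` A).
Proof.
move=> cA; have := measurableC (measurable_vec_open (closed_openC cA)).
by rewrite preimage_setC setCK.
Qed.

End coordinates.
(** * Expansion of the integral of the sign *)

Section integral_on_V.
Variables (R : realType) (V : normedModType R) (dot : {dot V for (@idfun R)}).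
Variables (n : nat) (b : 'I_n -> V).
Hypothesis b_basis : orthonormal_basis dot b.
Local Notation T := (n.-tuple (measurableTypeR R)).
Local Notation mu := (lebesgue_tuple R n).
Local Notation vec := (vec b).
Local Notation refl := (reflection dot).

Lemma measurable_sgr (f : T -> R) : measurable_fun [set: T] f ->
  measurable_fun [set: T] (fun t => Num.sg (f t)).
Proof.
move=> mf; rewrite (_ : (fun t => _) = fun t =>
    \1_(f @^-1` `]0, +oo[%classic) t - \1_(f @^-1` `]-oo, 0[%classic) t).
  apply: measurable_funB; apply: measurable_indic;
  by rewrite -[X in measurable X]setTI; apply: mf => //; exact: measurable_itv.
apply/funext => t; rewrite !indicE.
have E1 : (t \in f @^-1` `]0, +oo[%classic) = (0 < f t).
  by apply/idP/idP; rewrite inE /= in_itv /= andbT.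
have E2 : (t \in f @^-1` `]-oo, 0[%classic) = (f t < 0).
  by apply/idP/idP; rewrite inE /= in_itv.
by rewrite E1 E2; case: sgrP => _; rewrite ?subrr ?subr0 ?sub0r.
Qed.

(** A class of functions integrable on every measurable set of finite volume and, unlike
    integrability, stable under products. *)
Definition tame (f : V -> R) := measurable_fun [set: T] (fun t => f (vec t)) /\
  exists M, forall x, `|f x| <= M.

Lemma tameM f g : tame f -> tame g -> tame (fun x => f x * g x).
Proof.
move=> [mf [M fM]] [mg [N gN]]; split; first exact: measurable_funM.
by exists (M * N) => x; rewrite normrM ler_pM.
Qed.

Lemma tameD f g : tame f -> tame g -> tame (fun x => f x + g x).
Proof.
move=> [mf [M fM]] [mg [N gN]]; split; first exact: measurable_funD.
by exists (M + N) => x; rewrite (le_trans (ler_normD _ _))// lerD.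
Qed.

Lemma tame_cst k : tame (fun=> k).
Proof. by split; [exact: measurable_cst|exists `|k|]. Qed.

Lemma tame_sum (I : Type) (s : seq I) (f : I -> V -> R) :
  (forall i, tame (f i)) -> tame (fun x => \sum_(i <- s) f i x).
Proof.
move=> tf; split; first by apply: measurable_sum => i; case: (tf i).
have /choice[M MP] : forall i, exists M, forall x, `|f i x| <= M.
  by move=> i; case: (tf i).
exists (\sum_(i <- s) M i) => x; apply: le_trans (ler_norm_sum _ _ _) _.
exact: ler_sum.
Qed.

Lemma tame_arr_sign (A : seq V) (g : V -> V) :
  (forall e, measurable_fun [set: T] (fun t => dot e (g (vec t)))) ->
  tame (fun x => arr_sign dot A (g x)).
Proof.
move=> mg; split.
  by apply: measurable_prod => e _; apply: measurable_sgr; exact: mg.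
exists 1 => x; rewrite /arr_sign; elim: A => [|e A IH].
  by rewrite big_nil normr1.
rewrite big_cons normrM mulr_ile1// normr_sg.
by case: (_ != _).
Qed.

Lemma tame_linear (phi : V -> V) f : {morph phi : x y / x + y} ->
  (forall k x, phi (k *: x) = k *: phi x) -> tame f -> tame (fun x => f (phi x)).
Proof.
move=> phiD phiZ [mf [M fM]]; split; last by exists M => x; exact: fM.
rewrite (_ : (fun t => _) = (fun t => f (vec t)) \o (fun t => crd dot b (phi (vec t)))).
  by apply: (measurableT_comp mf); exact: measurable_crd_linear.
by apply/funext => t /=; rewrite crdK.
Qed.

Variable L : set V.
Hypotheses (mL : measurable (vec @^-1` L)) (finL : (mu (vec @^-1` L) < +oo)%E).

Definition integralV (f : V -> R) : R := \int[mu]_(t in vec @^-1` L) f (vec t).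

Lemma tame_integrable f : tame f ->
  mu.-integrable (vec @^-1` L) (EFin \o (fun t => f (vec t))).
Proof.
move=> [mf [M fM]]; apply: measurable_bounded_integrable => //.
  exact: measurable_funS mf.
exists M; split; first exact: num_real.
by move=> x Mx t _; apply: le_trans (ltW Mx); exact: fM.
Qed.

Lemma integralV_sum (I : Type) (s : seq I) (f : I -> V -> R) :
  (forall i, tame (f i)) ->
  integralV (fun x => \sum_(i <- s) f i x) = \sum_(i <- s) integralV (f i).
Proof.
move=> tf; elim: s => [|i s IH].
  rewrite big_nil /integralV; under eq_Rintegral do rewrite big_nil.
  by rewrite Rintegral_cst// mul0r.
rewrite big_cons -IH /integralV -RintegralD//; last 2 first.
- exact: (@tame_integrable (f i)).
- by apply: (@tame_integrable (fun x => \sum_(i <- s) f i x)); exact: tame_sum.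
by apply: eq_Rintegral => t _; rewrite big_cons.
Qed.

Lemma integralVD f g : tame f -> tame g ->
  integralV (fun x => f x + g x) = integralV f + integralV g.
Proof.
move=> tf tg; rewrite /integralV RintegralD//.
- exact: (@tame_integrable f).
- exact: (@tame_integrable g).
Qed.

Lemma integralVZ k f : tame f -> integralV (fun x => k * f x) = k * integralV f.
Proof. by move=> tf; rewrite /integralV RintegralZl//; exact: (@tame_integrable f). Qed.

(** The exceptional set is a finite union of affine hyperplanes, hence null; a pair in [s] is a
    normal with a level. *)
Lemma ae_eq_integralV (s : seq (V * R)) f g : tame f -> tame g ->
    {in s, forall q, q.1 != 0} ->
    (forall x, L x -> {in s, forall q, dot q.1 x != q.2} -> f x = g x) ->
  integralV f = integralV g.
Proof.
move=> tf tg s0 fg; rewrite /integralV /Rintegral; congr fine.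
have [mf _] := tf; have [mg _] := tg.
apply: ae_eq_integral => //.
- by apply/measurable_EFinP; exact: measurable_funS mf.
- by apply/measurable_EFinP; exact: measurable_funS mg.
pose N := \bigcup_(q in [set` s]) (vec @^-1` [set x | dot q.1 x = q.2]).
have mN q : measurable (vec @^-1` [set x | dot q.1 x = q.2]).
  rewrite (_ : _ @^-1` _ = (fun t => dot q.1 (vec t)) @^-1` [set q.2])//.
  by rewrite -[X in measurable X]setTI; exact: measurable_dot_vec.
exists N; split.
- by apply: fin_bigcup_measurable.
- rewrite /N bigcup_seq; elim: s s0 {fg N} => [|q s IH] s0.
    by rewrite big_nil measure0.
  rewrite big_cons measureU0//.
  + by apply: (volume_hyperplane0 b_basis); apply: s0; rewrite mem_head.
  + by rewrite -bigcup_seq; exact: fin_bigcup_measurable.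
  + by apply: IH => q' q's; apply: s0; rewrite inE q's orbT.
- move=> t /= H; apply: contrapT => tN; apply: H => Lt; congr EFin.
  apply: fg => // q qs; apply/eqP => qE; apply: tN; exists q => //.
Qed.

Lemma integralV_involution (phi : V -> V) (f : V -> R) :
    {morph phi : x y / x + y} -> (forall k x, phi (k *: x) = k *: phi x) ->
    involutive phi -> (forall x, L x -> L (phi x)) -> tame f ->
  integralV (fun x => f (phi x)) = integralV f.
Proof.
move=> phiD phiZ phiK phiL tf; rewrite /integralV /Rintegral; congr fine.
pose h t := crd dot b (phi (vec t)).
have mh : measurable_fun [set: T] h by exact: measurable_crd_linear.
have [mf _] := tf.
have pL : h @^-1` (vec @^-1` L) = vec @^-1` L.
  apply/seteqP; split=> t; rewrite /preimage /= crdK//; last exact: phiL.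
  by move=> /phiL; rewrite phiK.
transitivity (\int[pushforward mu h]_(t in vec @^-1` L) (f (vec t))%:E)%E.
  rewrite (integral_pushforward mh)//; last 2 first.
  - exact/measurable_EFinP.
  - rewrite pL; rewrite (_ : _ \o _ = EFin \o (fun t => f (phi (vec t)))).
      by apply: (@tame_integrable (fun x => f (phi x))); exact: tame_linear.
    by apply/funext => t /=; rewrite crdK.
  by rewrite pL; apply: eq_integral => t _ /=; rewrite crdK.
apply: eq_measure_integral => A mA _; rewrite /pushforward.
have AE : vec @^-1` [set x | A (crd dot b x)] = A.
  by apply/seteqP; split=> t; rewrite /preimage /= vecK.
have := volume_involution b_basis phiD phiZ phiK (A := [set x | A (crd dot b x)]).
by rewrite AE => /(_ mA).
Qed.
End integral_on_V.
(** Encodes [0 < s_0 < s_1 < ... < 1]; the default 1 of [head] is the end of the time interval. *)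
Fixpoint time_chain (R : numDomainType) (s : seq R) : bool :=
  if s is a :: s' then (0 < a < head 1 s') && time_chain s' else true.

Lemma time_chain_itv (R : numDomainType) (s : seq R) : time_chain s ->
  {in s, forall a, 0 < a < 1}.
Proof.
elim: s => //= a s IH /andP[/andP[a0 ah] /[dup] cs /IH{}IH] c.
rewrite inE => /predU1P[->|]; last exact: IH.
rewrite a0 /=; case: s ah IH {cs} => //= d s ad IH.
by apply: lt_trans ad _; have /andP[] := IH d (mem_head _ _).
Qed.

Lemma time_chain_head (R : numDomainType) (s : seq R) : time_chain s ->
  0 < head 1 s.
Proof. by case: s => [|a s] //= /andP[/andP[]]. Qed.

Lemma measurable_time_chain d (T : measurableType d) (R : realType)
    (fs : seq (T -> R)) : (forall i, measurable_fun [set: T] (nth (cst 0) fs i)) ->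
  measurable [set t | time_chain [seq f t | f <- fs]].
Proof.
elim: fs => [|f fs IH] mfs /=.
  by rewrite (_ : mkset _ = setT)//; apply/seteqP.
have mf : measurable_fun [set: T] f by exact: (mfs 0).
have mh : measurable_fun [set: T] (fun t => head 1 [seq f t | f <- fs]).
  case: fs mfs {IH} => [|g fs] mfs /=; first exact: measurable_cst.
  exact: (mfs 1).
have m1 : measurable [set t | 0 < f t].
  have := @measurable_fun_ltr _ _ R setT (cst 0) f (measurable_cst _) mf
    measurableT [set true] Logic.I.
  by rewrite setTI.
have m2 : measurable [set t | f t < head 1 [seq f t | f <- fs]].
  have := measurable_fun_ltr mf mh measurableT (Y := [set true]) Logic.I.
  by rewrite setTI.
have m3 : measurable [set t | time_chain [seq f t | f <- fs]].
  by apply: IH => i; exact: (mfs i.+1).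
rewrite (_ : mkset _ = [set t | 0 < f t] `&` [set t | f t < head 1 [seq f t | f <- fs]] `&`
  [set t | time_chain [seq f t | f <- fs]]).
  by apply: measurableI => //; exact: measurableI.
apply/seteqP; split=> t /=; first by move=> /andP[/andP[]].
by move=> [[-> ->] ->].
Qed.

(** * Polynomial dependence along lines *)

Section pol_on_lines.
Variables (R : realType) (V : normedModType R).

(** Polynomiality is recorded on lines, with a bound on the degree, because the final argument
    counts roots on a line. *)
Definition pol_on_lines (n : nat) (Q : V -> R) :=
  forall x u, exists2 q : {poly R}, (size q <= n.+1)%N &
    forall t, Q (x + t *: u) = q.[t].

Lemma pol_on_lines_sum n (I : Type) (s : seq I) (c : I -> R) (Q : I -> V -> R) :
  (forall i, pol_on_lines n (Q i)) ->
  pol_on_lines n (fun x => \sum_(i <- s) c i * Q i x).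
Proof.
move=> pQ x u; have /choice[q qP] : forall i, exists q : {poly R},
    (size q <= n.+1)%N /\ forall t, Q i (x + t *: u) = q.[t].
  by move=> i; have [q ? ?] := pQ i x u; exists q.
exists (\sum_(i <- s) c i *: q i).
  elim/big_ind: _ => [|p1 p2 h1 h2|i _]; first by rewrite size_poly0.
    by rewrite (leq_trans (size_polyD _ _))// geq_max h1.
  by rewrite (leq_trans (size_scale_leq _ _))//; case: (qP i).
move=> t; rewrite horner_sum; apply: eq_bigr => i _.
by rewrite hornerZ; case: (qP i) => _ ->.
Qed.

Lemma pol_on_lines_prod (dot : {dot V for (@idfun R)}) k (s : seq V) :
  pol_on_lines (size s) (fun x => k * \prod_(e <- s) dot e x).
Proof.
move=> x u; exists (k *: \prod_(e <- s) ((dot e u)%:P * 'X + (dot e x)%:P)).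
  apply: leq_trans (size_scale_leq _ _) _; elim: s => [|e s IH] /=.
    by rewrite big_nil size_poly1.
  rewrite big_cons (leq_trans (size_polyMleq _ _))//.
  apply: (@leq_trans (2 + (size s).+1).-1); last by [].
  rewrite -!subn1 leq_sub2r// leq_add// (leq_trans (size_polyD _ _))// geq_max.
  rewrite (leq_trans (size_polyC_leq1 _))// andbT mul_polyC.
  by rewrite (leq_trans (size_scale_leq _ _))// size_polyX.
move=> t; rewrite hornerZ horner_prod; congr (_ * _); apply: eq_bigr => e _.
by rewrite dotDr dotZr hornerD hornerM !hornerC hornerX addrC mulrC.
Qed.

End pol_on_lines.

(** * Volume of the simplex of a complete flag *)

Section frame_volume.
Variables (R : realType) (V : normedModType R) (dot : {dot V for (@idfun R)}).
Variables (n : nat) (b : 'I_n -> V).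
Hypothesis b_basis : orthonormal_basis dot b.
Local Notation T := (n.-tuple (measurableTypeR R)).
Local Notation mu := (lebesgue_tuple R n).
Local Notation vec := (vec b).

Definition time_set (v : V) (p : seq V) : set V :=
  [set x | time_chain [seq crossing_time dot v e x | e <- p]].

Lemma measurable_crossing_time v e :
  measurable_fun [set: T] (fun t => crossing_time dot v e (vec t)).
Proof.
apply: measurable_funM; last exact: measurable_cst.
by apply: (@measurable_funN _ _ R); exact: measurable_dot_vec.
Qed.

Lemma measurable_time_set v p : measurable (vec @^-1` time_set v p).
Proof.
rewrite (_ : _ @^-1` _ = [set t : T | time_chain [seq f t |
    f <- [seq (fun t => crossing_time dot v e (vec t)) | e <- p]]]).
  apply: measurable_time_chain => i; have [ip|ip] := ltnP i (size p).
    by rewrite (nth_map 0)//; exact: measurable_crossing_time.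
  by rewrite nth_default ?size_map//; exact: measurable_cst.
by apply/seteqP; split=> t; rewrite /preimage /= /time_set /= -map_comp.
Qed.

(** In the coordinates of the frame [p], crossing times are coordinates divided by [-(e, v)], so the
    set is a diagonal image of one fixed simplex. The constant comes from the change of frame [phi]
    and from that simplex, and does not involve [v]. *)
Lemma volume_time_set (p : seq V) : size p = n ->
    {in p, forall e, dot e e = 1} -> orthogonal_seq dot p ->
  exists k : R, forall v, {in p, forall e, dot e v != 0} ->
    mu (vec @^-1` time_set v p) = (k * \prod_(e <- p) `|dot e v|)%:E.
Proof.
move=> sp pu [up op]; pose f (i : 'I_n) := nth 0 p i.
have fp i : f i \in p by rewrite mem_nth// sp.
have of_ i j : dot (f i) (f j) = (i == j)%:R.
  have [->|ij] := eqVneq i j; first by rewrite pu.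
  by rewrite op// nth_uniq ?sp.
have pE : p = [seq f i | i <- enum 'I_n].
  by rewrite -[LHS](mkseq_nth 0) /mkseq sp -val_enum_ord -map_comp.
have [ob _] := b_basis.
pose phi x := \sum_i dot (f i) x *: b i.
pose psi y := \sum_i dot (b i) y *: f i.
have phiE i x : dot (b i) (phi x) = dot (f i) x.
  rewrite dot_sumr (bigD1 i)//= dotZr ob eqxx mulr1 big1 ?addr0// => j ji.
  by rewrite dotZr ob eq_sym (negbTE ji) mulr0.
have psiE i x : dot (f i) (psi x) = dot (b i) x.
  rewrite dot_sumr (bigD1 i)//= dotZr of_ eqxx mulr1 big1 ?addr0// => j ji.
  by rewrite dotZr of_ eq_sym (negbTE ji) mulr0.
have phiK : cancel phi psi.
  move=> x; rewrite [RHS](frame_expand b_basis of_); apply: eq_bigr => i _.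
  by rewrite phiE.
have psiK : cancel psi phi.
  move=> x; rewrite [RHS](basis_expand b_basis); apply: eq_bigr => i _.
  by rewrite psiE.
have lin (g h : 'I_n -> V) : {morph (fun x => \sum_i dot (g i) x *: h i) : x y / x + y} /\
    forall k x, \sum_i dot (g i) (k *: x) *: h i = k *: \sum_i dot (g i) x *: h i.
  split=> [x y|k x]; first by rewrite -big_split; apply: eq_bigr => i _; rewrite dotDr scalerDl.
  by rewrite scaler_sumr; apply: eq_bigr => i _; rewrite dotZr scalerA.
have [phiD phiZ] := lin f b; have [psiD psiZ] := lin b f.
have [k0 k0_gt0 k0P] := volume_linear b_basis phiD phiZ psiD psiZ phiK psiK.
pose coord (i : 'I_n) : T -> R := fun t => tnth t i.
pose C : set T := [set t | time_chain [seq g t | g <- map coord (enum 'I_n)]].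
have mC : measurable C.
  apply: measurable_time_chain => i; have [ip|ip] := ltnP i n.
    rewrite (nth_map (Ordinal ip)) ?size_enum_ord//; exact: measurable_tnth.
  rewrite nth_default; first exact: measurable_cst.
  by rewrite size_map size_enum_ord.
have finC : (mu C < +oo)%E.
  apply: (@le_lt_trans _ _ (mu (tuple_box 1))); last by rewrite lebesgue_tuple_box// ltry.
  apply: le_measure; rewrite ?inE//; first exact: measurable_tuple_box.
  move=> t /= /time_chain_itv H i.
  have /H /andP[t0 t1] : (tnth t i : R) \in [seq g t | g <- map coord (enum 'I_n)].
    by rewrite -map_comp; apply/mapP; exists i; rewrite ?mem_enum.
  by rewrite gtr0_norm// ltW.
exists (k0 * fine (mu C)) => v pv.
have fv i : dot (f i) v != 0 by exact: pv.
pose A := [set y | time_chain [seq - dot (b i) y / dot (f i) v | i <- enum 'I_n]].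
have AE : vec @^-1` A = tuple_affine (fun i => - (dot (f i) v)^-1) (fun=> 0) @^-1` C.
  suff E t : [seq - dot (b i) (vec t) / dot (f i) v | i <- enum 'I_n] =
    [seq g (tuple_affine (fun i => - (dot (f i) v)^-1) (fun=> 0) t) |
      g <- map coord (enum 'I_n)].
    by apply/seteqP; split=> t; rewrite /A /C /preimage /= E.
  rewrite -map_comp; apply: eq_map => i /=.
  by rewrite /coord tnth_mktuple addr0 (dot_vec b_basis) !mulNr mulrC.
have mA : measurable (vec @^-1` A).
  by rewrite AE -[X in measurable X]setTI; exact: measurable_tuple_affine.
have -> : vec @^-1` time_set v p = vec @^-1` (phi @^-1` A).
  suff E x : [seq - dot (b i) (phi x) / dot (f i) v | i <- enum 'I_n] =
      [seq crossing_time dot v e x | e <- p].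
    by apply/seteqP; split=> t; rewrite /A /time_set /preimage /= E.
  by rewrite pE -[RHS]map_comp; apply: eq_map => i /=; rewrite phiE.
rewrite k0P// AE.
have k_neq0 i : - (dot (f i) v)^-1 != 0 by rewrite oppr_eq0 invr_eq0.
have := lebesgue_tuple_affine (fun=> 0) k_neq0 mC.
have prodE : \prod_(e <- p) `|dot e v| * \prod_i `|- (dot (f i) v)^-1| = 1.
  rewrite pE big_map big_enum -big_split big1//= => i _.
  by rewrite normrN normfV mulfV// normr_eq0.
have -> : mu C = (fine (mu C))%:E by rewrite fineK// ge0_fin_numE.
move=> /(congr1 (fun z => (\prod_(e <- p) `|dot e v|)%:E * z)%E).
rewrite muleA -EFinM prodE mul1e => ->; rewrite -!EFinM; congr EFin; ring.
Qed.
End frame_volume.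

(** * Expansion along flags of orthogonal roots *)

Section expansion.
Variables (R : realType) (V : normedModType R) (dot : {dot V for (@idfun R)}).
Variables (n : nat) (b : 'I_n -> V).
Hypothesis b_basis : orthonormal_basis dot b.
Variable E : seq V.
Hypothesis rE : root_seq dot E.
Hypothesis E_ext : forall s, {subset s <= E} -> orthogonal_seq dot s ->
  (size s < n)%N -> exists2 e, e \in E & {in s, forall a, dot a e = 0}.
Local Notation T := (n.-tuple (measurableTypeR R)).
Local Notation mu := (lebesgue_tuple R n).
Local Notation vec := (vec b).
Local Notation refl := (reflection dot).
Local Notation time := (crossing_time dot).

(** The properties of [L] that the expansion uses. Centred balls share them, so one polynomial
    serves for [L] and for balls. *)
Definition admissible (L : set V) :=
  [/\ measurable (vec @^-1` L), (mu (vec @^-1` L) < +oo)%E,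
      forall x y (t : R), L x -> L y -> 0 <= t <= 1 -> L ((1 - t) *: x + t *: y) &
      forall e x, e \in E -> L x -> L (refl e x)].

Definition roots_orth (p : seq V) := foldr (fun e A => orth_roots dot A e) E p.

(** Flags grow at the head and backwards in time, so the head has the earliest crossing. With the
    default 1, the empty flag looks at [x + v]. *)
Definition last_time v (p : seq V) x := head 1 [seq time v e x | e <- p].

(* [p = [:: e_k; ...; e_1]] is a flag of orthogonal roots; [time_set] asks that
   the line through [x] directed by [v] crosses [e_k], ..., [e_1] in this order
   between the times [0] and [1]. *)
Definition flag_integrand v p x : R :=
  \1_(time_set dot v p) x * arr_sign dot (roots_orth p) (x + last_time v p x *: v).

Fixpoint root_flag (p : seq V) : bool :=
  if p is e :: p' then (e \in roots_orth p') && root_flag p' else true.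

Lemma mem_roots_orth p f :
  (f \in roots_orth p) = (f \in E) && all (fun e => dot e f == 0) p.
Proof.
elim: p => [|e p IH] /=; first by rewrite andbT.
by rewrite mem_filter IH; case: (f \in E); rewrite ?andbF// .
Qed.

Lemma root_seq_roots_orth p : root_seq dot (roots_orth p).
Proof. by elim: p => //= e p; exact: root_seq_orth. Qed.

Lemma root_flag_sub p : root_flag p -> {subset p <= E}.
Proof.
elim: p => //= e p IH /andP[+ /IH pE] x; rewrite mem_roots_orth => /andP[eE _].
by rewrite inE => /predU1P[->//|/pE].
Qed.

Let E_unit : {in E, forall e, dot e e = 1}. Proof. by case: rE. Qed.

Lemma root_flag_orth p : root_flag p -> orthogonal_seq dot p.
Proof.
elim: p => [_|e p IH]; first by split.
rewrite /= => /andP[]; rewrite mem_roots_orth => /andP[eE /allP ep] /IH op.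
apply/orthogonal_seq_cons; split=> //.
  by apply/negP => /ep; rewrite E_unit// oner_eq0.
by move=> x /ep /eqP.
Qed.

Lemma time_set_cons v e p x :
  time_set dot v (e :: p) x <-> (0 < time v e x < last_time v p x) /\ time_set dot v p x.
Proof. by rewrite /time_set /=; split=> [/andP[]|[-> ->]]. Qed.

Lemma measurable_last_time v p : measurable_fun [set: T] (fun t => last_time v p (vec t)).
Proof.
case: p => [|e p]; first exact: measurable_cst.
exact: measurable_crossing_time.
Qed.

Lemma tame_indicator A : measurable (vec @^-1` A) -> tame b (\1_A : V -> R).
Proof.
move=> mA; split; last by exists 1 => x; rewrite indicE; case: (_ \in _); rewrite ?normr1 ?normr0.
exact: measurable_indic mA.
Qed.

Lemma measurable_dot_moving (g : V -> R) v e : measurable_fun [set: T] (fun t => g (vec t)) ->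
  measurable_fun [set: T] (fun t => dot e (vec t + g (vec t) *: v)).
Proof.
move=> mg; rewrite (_ : (fun t => _) = fun t => dot e (vec t) + g (vec t) * dot e v).
  apply: measurable_funD; first exact: measurable_dot_vec.
  by apply: measurable_funM => //; exact: measurable_cst.
by apply/funext => t; rewrite dotDr dotZr.
Qed.

Lemma tame_flag_integrand v p : tame b (flag_integrand v p).
Proof.
apply: tameM; first by apply: tame_indicator; exact: measurable_time_set.
apply: (@tame_arr_sign _ _ dot _ b _ (fun x => x + last_time v p x *: v)) => e.
by apply: measurable_dot_moving; exact: measurable_last_time.
Qed.

Lemma time_refl v a e x : dot e a = 0 -> time v e (refl a x) = time v e x.
Proof. by move=> ea; rewrite /crossing_time dot_reflr ea mulr0 subr0. Qed.

Lemma integral_anti L (f : V -> R) a : admissible L -> a \in E -> tame b f ->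
  (forall x, f (refl a x) = - f x) -> integralV b L f = 0.
Proof.
move=> [mL finL _ iL] aE tf fa.
have : integralV b L (fun x => f (refl a x)) = integralV b L f.
  apply: (integralV_involution b_basis mL finL (phi := refl a) (f := f)) => //.
  - exact: reflD.
  - exact: reflZ.
  - by move=> x; rewrite reflK// E_unit.
  - by move=> x; exact: iL.
rewrite (_ : (fun x => _) = fun x => -1 * f x); last by apply/funext => x; rewrite mulN1r.
rewrite (integralVZ (L := L))// mulN1r => H; lra.
Qed.

(** The reflection in [a], which is orthogonal to all of [p], preserves the crossing times of [p]
    and reverses the sign of the remaining roots. *)
Lemma integral_flag_start L v p a : admissible L -> a \in roots_orth p ->
  integralV b L (fun x => \1_(time_set dot v p) x * arr_sign dot (roots_orth p) x) = 0.
Proof.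
move=> aL ap; have := ap; rewrite mem_roots_orth => /andP[aE /allP pa].
apply: (integral_anti (a := a)) => //.
  apply: tameM; first by apply: tame_indicator; exact: measurable_time_set.
  by apply: (@tame_arr_sign _ _ dot _ b _ id) => e; exact: measurable_dot_vec.
move=> x; rewrite (arr_sign_refl (root_seq_roots_orth p))// mulrN; congr (- (_ * _)).
rewrite !indicE; congr (_%:R); congr nat_of_bool.
suff E' : [seq time v e (refl a x) | e <- p] = [seq time v e x | e <- p].
  by apply/idP/idP; rewrite !inE /time_set /= E'.
by apply/eq_in_map => e /pa /eqP ea; exact: time_refl.
Qed.

(** The sign of the roots orthogonal to [p] is followed from time 0 to [last_time v p x]. Its
    initial value integrates to zero, thanks to the root given by [E_ext], and the crossing of [e]
    produces the integrand of [e :: p]. *)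
Lemma flag_integral_step p : root_flag p -> (size p < n)%N ->
  exists k : V -> R, forall L v, admissible L -> {in E, forall e, dot e v != 0} ->
    integralV b L (flag_integrand v p) =
    \sum_(e <- roots_orth p) 2 * Num.sg (dot e v) * k e * integralV b L (flag_integrand v (e :: p)).
Proof.
move=> fp pn; have pE := root_flag_sub fp; have op := root_flag_orth fp.
have [k kP] := arr_sign_crossings (root_seq_roots_orth p).
exists k => L v aL Ev; have [mL finL _ _] := aL.
have [a ap] : exists a, a \in roots_orth p.
  have [e eE ep] := E_ext pE op pn; exists e; rewrite mem_roots_orth eE.
  by apply/allP => x /ep ->.
have AE : {subset roots_orth p <= E} by move=> e; rewrite mem_roots_orth => /andP[].
have tf1 : tame b (fun x => \1_(time_set dot v p) x * arr_sign dot (roots_orth p) x : R).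
  apply: tameM; first by apply: tame_indicator; exact: measurable_time_set.
  by apply: (@tame_arr_sign _ _ dot _ b _ id) => e; exact: measurable_dot_vec.
have tf2 e : tame b (fun x => 2 * Num.sg (dot e v) * k e * flag_integrand v (e :: p) x).
  by apply: tameM; [exact: tame_cst|exact: tame_flag_integrand].
transitivity (integralV b L (fun x => \1_(time_set dot v p) x * arr_sign dot (roots_orth p) x +
  \sum_(e <- roots_orth p) 2 * Num.sg (dot e v) * k e * flag_integrand v (e :: p) x)); last first.
  rewrite integralVD//; last exact: tame_sum.
  rewrite (integral_flag_start _ aL ap) add0r integralV_sum//; apply: eq_bigr => e _.
  by rewrite integralVZ//; exact: tame_flag_integrand.
(* Excluded positions: [x] on a hyperplane, [x + v] on a hyperplane, and two hyperplanes crossed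
   simultaneously. *)
pose s := [seq (e, 0) | e <- E] ++ [seq (e, - dot e v) | e <- E] ++
  [seq (dot ef.2 v *: ef.1 - dot ef.1 v *: ef.2, 0) | ef <-
     [seq ef <- [seq (e, f) | e <- E, f <- E] | ef.1 != ef.2]].
have E_neq0 e : e \in E -> e != 0.
  by move=> /E_unit ee; apply: contra_eq_neq ee => ->; rewrite dot0l eq_sym oner_neq0.
apply: (ae_eq_integralV b_basis mL (s := s)) => //.
- exact: tame_flag_integrand.
- by apply: tameD => //; exact: tame_sum.
- move=> q; rewrite !mem_cat => /or3P[/mapP[e eE ->]|/mapP[e eE ->]|] /=.
  + exact: E_neq0.
  + exact: E_neq0.
  + move=> /mapP[[e f]]; rewrite mem_filter => /andP[/= ef /allpairsP[[e' f'] /= [eE fE [??]]]] ->.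
    subst e' f'; rewrite /= subr_eq0; apply: contraNneq ef => H.
    have fE' : f = (dot f v / dot e v) *: e.
      by rewrite mulrC -scalerA H scalerA mulVf ?scale1r// Ev.
    have [->//|fe] := unit_proportional (E_unit eE) (E_unit fE) fE'.
    by have [_ _ /(_ e eE) + _] := rE; rewrite -fe fE.
move=> x _ gx.
have g0 e : e \in E -> dot e x != 0.
  by move=> eE; apply: (gx (e, 0)); rewrite mem_cat map_f.
have g1 e : e \in E -> dot e x != - dot e v.
  move=> eE; apply: (gx (e, - dot e v)).
  by rewrite !mem_cat (map_f (fun e => (e, - dot e v)))// orbT.
have ginj : {in E &, injective (time v ^~ x)}.
  move=> e f eE fE ef; apply/eqP; apply: contraT => neq.
  have : dot (dot f v *: e - dot e v *: f) x != 0.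
    apply: (gx (dot f v *: e - dot e v *: f, 0)); rewrite !mem_cat; apply/or3P/Or33.
    apply/mapP; exists (e, f) => //; rewrite mem_filter /= neq.
    by apply/allpairsP; exists (e, f).
  have {ef} : dot e x / dot e v = dot f x / dot f v.
    by move: ef; rewrite /crossing_time !mulNr => /oppr_inj.
  rewrite dotBl !dotZl => ef; rewrite subr_eq0 => /eqP; case.
  have -> : dot e x = dot f x / dot f v * dot e v by rewrite -ef divfK// Ev.
  by field; exact: Ev.
rewrite /flag_integrand [\1_(time_set _ _ p) x]indicE.
have [xp|xp] := boolP (x \in _); last first.
  rewrite !mul0r add0r big1// => e _; rewrite indicE.
  case: (boolP (x \in _)); last by rewrite !(mul0r, mulr0).
  by rewrite inE => /time_set_cons[_ /mem_set]; rewrite (negbTE xp).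
rewrite !mul1r (kP x v) //; last first.
(* No remaining root is crossed at the final time: for the empty flag this time is 1, and otherwise
   it is the time of the head [f], which is not orthogonal to itself. *)
- move=> e /[dup] ep /AE eE; case: p xp fp {pE op pn k kP ap tf1 tf2 AE} ep => [|f p] xp fp ep.
    rewrite /last_time /= /crossing_time; apply: contra (g1 _ eE).
    move=> /eqP H; have : - dot e x = dot e v by rewrite -[RHS]mul1r -H divfK// Ev.
    by move=> <-; rewrite opprK.
  rewrite /last_time /=; apply: contraTneq ep => H.
  have fE : f \in E by apply: root_flag_sub fp _ (mem_head _ _).
  by rewrite (ginj _ _ eE fE H) mem_roots_orth /= E_unit// oner_eq0 /= andbF.
- move=> e /AE eE; rewrite /crossing_time mulf_neq0 ?oppr_eq0 ?g0//.
  by rewrite invr_eq0 Ev.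
- by move=> e f /AE eE /AE fE; exact: ginj.
- by move=> e /AE; exact: Ev.
- by rewrite inE in xp; exact: time_chain_head.
congr (_ + _); rewrite big_mkcond /=; apply: eq_bigr => e _.
rewrite indicE; case: ifPn => et.
  rewrite mem_set ?mul1r//; apply/time_set_cons; split=> //.
  by rewrite inE in xp.
rewrite memNset ?mul0r ?mulr0// => /time_set_cons[H _].
by rewrite H in et.
Qed.

Lemma frame_expand_seq p : size p = n -> {in p, forall e, dot e e = 1} ->
  orthogonal_seq dot p -> forall x, x = \sum_(e <- p) dot e x *: e.
Proof.
move=> sp pu [up op] x; pose f (i : 'I_n) := nth 0 p i.
have fp i : f i \in p by rewrite mem_nth// sp.
have of_ i j : dot (f i) (f j) = (i == j)%:R.
  have [->|ij] := eqVneq i j; first by rewrite pu.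
  by rewrite op// nth_uniq ?sp.
rewrite {1}(frame_expand b_basis of_ x) (big_nth 0) sp big_mkord.
by apply: eq_bigr.
Qed.

(** Multiplying the coordinate along [e] by [c e] is a convex combination of the identity and the
    reflection in [e]; by orthogonality the roots can be treated one at a time. *)
Lemma admissible_contract L p (c : V -> R) x : admissible L -> {subset p <= E} ->
    orthogonal_seq dot p -> {in p, forall e, -1 <= c e <= 1} -> L x ->
  L (x + \sum_(e <- p) ((c e - 1) * dot e x) *: e).
Proof.
move=> [_ _ cL iL]; elim: p => [|e p IH] pE; first by rewrite big_nil addr0.
move=> /orthogonal_seq_cons[_ op pe] pc Lx.
have Ly := IH (fun y yp => pE y (mem_behead (s := e :: p) yp)) op
  (fun y yp => pc y (mem_behead (s := e :: p) yp)) Lx.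
set y := x + _ in Ly.
have ey : dot e y = dot e x.
  rewrite /y dotDr dot_sumr big1_seq ?addr0// => f /= fp.
  by rewrite dotZr (dotC _ e) pe// mulr0.
have eE : e \in E by rewrite pE ?mem_head.
have /andP[c1 c2] := pc e (mem_head _ _).
(* The weight [t] solves [1 - 2 t = c e], where [1 - 2 t] is the factor by which the combination
   acts along [e]. *)
have := cL y (refl e y) ((1 - c e) / 2) Ly (iL _ _ eE Ly).
have t01 : 0 <= (1 - c e) / 2 <= 1 by apply/andP; split; lra.
move=> /(_ t01); rewrite big_cons addrCA -/y; clearbody y.
suff -> : (1 - (1 - c e) / 2) *: y + ((1 - c e) / 2) *: refl e y =
  ((c e - 1) * dot e x) *: e + y by [].
apply: (@dot_inj _ _ dot) => z.
by rewrite !(dotDr, dotZr, dot_reflr) ey; field.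
Qed.

(** Since [(e, x)] is [- time v e x] times [(e, v)], the point [x] arises from [v] by scaling its
    frame coordinates with factors between -1 and 0. *)
Lemma time_set_sub L v p : admissible L -> {subset p <= E} -> orthogonal_seq dot p ->
    size p = n -> {in E, forall e, dot e v != 0} -> L v ->
  time_set dot v p `<=` L.
Proof.
move=> aL pE op sp Ev Lv x /time_chain_itv xp.
have pu : {in p, forall e, dot e e = 1} by move=> e /pE; exact: E_unit.
have := admissible_contract (c := fun e => - time v e x) aL pE op _ Lv.
have -> : v + \sum_(e <- p) ((- time v e x - 1) * dot e v) *: e = x.
  rewrite {1}(frame_expand_seq sp pu op v) -big_split /=.
  rewrite [RHS](frame_expand_seq sp pu op x); apply: eq_big_seq => e /pE eE.
  rewrite -scalerDl /crossing_time; congr (_ *: _).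
  by field; exact: Ev.
apply=> e ep.
have /xp/andP[t0 t1] : time v e x \in [seq time v e x | e <- p] by exact: map_f.
by apply/andP; split; lra.
Qed.

(** A complete flag leaves no orthogonal root, so the sign is an empty product and the integral is a
    volume. Each [|(e, v)|] splits into a sign and a linear factor. *)
Lemma flag_integral_full p : root_flag p -> size p = n -> exists k : R,
  forall L v, admissible L -> L v -> {in E, forall e, dot e v != 0} ->
    integralV b L (flag_integrand v p) =
    \prod_(e <- p) Num.sg (dot e v) * (k * \prod_(e <- p) dot e v).
Proof.
move=> fp sp; have pE := root_flag_sub fp; have op := root_flag_orth fp.
have pu : {in p, forall e, dot e e = 1} by move=> e /pE; exact: E_unit.
have [k kP] := volume_time_set b_basis sp pu op.
exists k => L v aL Lv Ev.
have r0 : roots_orth p = [::].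
  case rp : (roots_orth p) => [//|e s].
  have : e \in roots_orth p by rewrite rp mem_head.
  rewrite mem_roots_orth => /andP[eE /allP pe].
  have := E_unit eE; rewrite [X in dot e X](frame_expand_seq sp pu op e).
  rewrite big1_seq ?dot0r; first by move=> /eqP; rewrite eq_sym oner_eq0.
  by move=> f /= /pe /eqP ->; rewrite scale0r.
have [mL _ _ _] := aL.
have mts := measurable_time_set dot b v p.
transitivity (integralV b L (\1_(time_set dot v p) : V -> R)).
  apply: eq_Rintegral => t _; rewrite /flag_integrand r0 /arr_sign big_nil.
  by rewrite mulr1.
transitivity (fine (mu (vec @^-1` time_set dot v p))).
  rewrite /integralV /Rintegral; congr fine.
  rewrite (eq_integral (fun t => (\1_(vec @^-1` time_set dot v p) t)%:E))//.
  rewrite integral_indic//; congr (mu _); apply/seteqP; split=> t; first by case.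
  by move=> tp; split=> //; exact: (time_set_sub aL pE op sp Ev Lv).
rewrite kP /=; last by move=> e /pE; exact: Ev.
rewrite mulrCA -big_split /=; congr (_ * _); apply: eq_bigr => e _.
by rewrite normrEsg.
Qed.

(* [Q] does not depend on [L], so its antisymmetry can be read off any ball. *)
Lemma flag_integral_polynomial p : root_flag p -> (size p <= n)%N ->
  exists2 Q : V -> R, pol_on_lines n Q &
  forall L v, admissible L -> L v -> {in E, forall e, dot e v != 0} ->
    integralV b L (flag_integrand v p) = \prod_(e <- p) Num.sg (dot e v) * Q v.
Proof.
have [m] := ubnP (n - size p)%N; elim: m p => // m IH p pm fp pn.
have [np|{}pn] := leqP n (size p).
  have sp : size p = n by apply/eqP; rewrite eqn_leq pn.
  have [k kP] := flag_integral_full fp sp.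
  exists (fun v => k * \prod_(e <- p) dot e v) => //.
  by rewrite -[n in pol_on_lines n]sp; exact: pol_on_lines_prod.
have [k kP] := flag_integral_step fp pn.
have /choice[Q QP] : forall e, exists Q : V -> R, pol_on_lines n Q /\
    (e \in roots_orth p -> forall L v, admissible L -> L v ->
      {in E, forall e, dot e v != 0} ->
      integralV b L (flag_integrand v (e :: p)) =
      \prod_(f <- e :: p) Num.sg (dot f v) * Q v).
  move=> e; have [ep|ep] := boolP (e \in roots_orth p); last first.
    exists (fun=> 0); split=> // x u; exists 0; first by rewrite size_poly0.
    by move=> t; rewrite horner0.
  have [|||Q pQ QP] := IH (e :: p).
  - by rewrite /= -ltnS; apply: leq_trans pm; rewrite ltnS subnS prednK// subn_gt0.
  - by rewrite /= ep.
  - exact: pn.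
  by exists Q; split.
exists (fun v => \sum_(e <- roots_orth p) (2 * k e) * Q e v).
  by apply: pol_on_lines_sum => e; case: (QP e).
move=> L v aL Lv Ev; rewrite (kP L v aL Ev) big_distrr /=.
apply: eq_big_seq => e ep; have [_ /(_ ep L v aL Lv Ev) ->] := QP e.
rewrite big_cons.
(* The sign of [(e, v)] produced by the jump cancels the one carried by the flag [e :: p], leaving
   the signs of [p]. *)
have sg2 : Num.sg (dot e v) * Num.sg (dot e v) = 1.
  have eE : e \in E by move: ep; rewrite mem_roots_orth => /andP[].
  by rewrite -sgrM gtr0_sg// -expr2 exprn_even_gt0//= Ev.
transitivity (Num.sg (dot e v) * Num.sg (dot e v) *
  (\prod_(f <- p) Num.sg (dot f v) * (2 * k e * Q e v))); first by ring.
by rewrite sg2 mul1r.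
Qed.

Lemma integral_arr_sign_polynomial : exists2 Q : V -> R, pol_on_lines n Q &
  forall L v, admissible L -> L v -> {in E, forall e, dot e v != 0} ->
    integralV b L (fun x => arr_sign dot E (x + v)) = Q v.
Proof.
have [Q pQ QP] := @flag_integral_polynomial [::] isT isT.
exists Q => // L v aL Lv Ev; rewrite -[RHS]mul1r.
have := QP L v aL Lv Ev; rewrite big_nil => <-.
apply: eq_Rintegral => t _; rewrite /flag_integrand indicE mem_set// mul1r.
by rewrite /last_time /= scale1r.
Qed.

Hypothesis norm_dot : forall x : V, `|x| ^+ 2 = dot x x.

Lemma norm_refl e x : e \in E -> `|refl e x| = `|x|.
Proof.
move=> eE; apply/eqP; rewrite -(@eqrXn2 _ 2)//; apply/eqP.
by rewrite !norm_dot refl_isom// E_unit.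
Qed.

Lemma admissible_ball r : admissible [set x | `|x| <= r].
Proof.
have mB : measurable (vec @^-1` [set x | `|x| <= r]).
  apply: (measurable_vec_closed norm_dot b_basis).
  apply: (@closed_comp _ _ (fun x : V => `|x|) [set y | y <= r]).
    by move=> x _; exact: norm_continuous.
  exact: closed_le.
split=> //.
- exact: (volume_bounded_fin norm_dot b_basis (r := r)).
- move=> x y t /= xr yr /andP[t0 t1].
  apply: le_trans (ler_normD _ _) _; rewrite !normrZ !ger0_norm ?subr_ge0//.
  have -> : r = (1 - t) * r + t * r by ring.
  by rewrite lerD// ler_wpM2l// subr_ge0.
- by move=> e x eE /=; rewrite norm_refl.
Qed.

Lemma tame_arr_sign_translate v : tame b (fun x => arr_sign dot E (x + v)).
Proof.
apply: (@tame_arr_sign _ _ dot _ b _ (fun x => x + v)) => e.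
rewrite (_ : (fun t => _) = fun t => dot e (vec t) + dot e v).
  by apply: measurable_funD; [exact: measurable_dot_vec|exact: measurable_cst].
by apply/funext => t; rewrite dotDr.
Qed.

(** Change variables by the reflection in [a], which preserves [L], and use the antisymmetry of
    [arr_sign]. *)
Lemma integral_arr_sign_refl L v a : admissible L -> a \in E ->
  integralV b L (fun x => arr_sign dot E (x + refl a v)) =
  - integralV b L (fun x => arr_sign dot E (x + v)).
Proof.
move=> [mL finL _ iL] aE.
rewrite -mulN1r -(integralVZ mL finL); last exact: tame_arr_sign_translate.
rewrite -[LHS](integralV_involution b_basis mL finL (phi := refl a)).
- apply: eq_Rintegral => t _.
  by rewrite -reflD arr_sign_refl// mulN1r.
- exact: reflD.
- exact: reflZ.
- by move=> x; rewrite reflK// E_unit.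
- by move=> x; exact: iL.
- exact: tame_arr_sign_translate.
Qed.

Lemma regular_refl v a : a \in E -> {in E, forall e, dot e v != 0} ->
  {in E, forall e, dot e (refl a v) != 0}.
Proof.
move=> aE Ev e eE; rewrite dot_refl_swap; have [_ _ _ cE] := rE.
by have [/Ev//|/Ev] := cE _ _ aE eE; rewrite dotNl oppr_eq0.
Qed.

Lemma integral_arr_sign_eq0 L v : (n < size E)%N -> admissible L -> L v ->
  integralV b L (fun x => arr_sign dot E (x + v)) = 0.
Proof.
move=> nE aL Lv.
have [Ev|] := pselect {in E, forall e, dot e v != 0}; last first.
  (* If [v] lies on a hyperplane, a reflection fixes it and the integral equals its opposite. *)
  move=> /existsNP[a /not_implyP[aE /negP]]; rewrite negbK => /eqP av.
  have := integral_arr_sign_refl v aL aE; rewrite refl_orth// => H; lra.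
have [Q pQ QP] := integral_arr_sign_polynomial.
rewrite (QP L v aL Lv Ev).
have Qanti a u : a \in E -> {in E, forall e, dot e u != 0} -> Q (refl a u) = - Q u.
  move=> aE Eu; have aB := admissible_ball `|u|.
  rewrite -(QP _ _ aB _ (regular_refl aE Eu)) /=; last by rewrite norm_refl.
  by rewrite -(QP _ _ aB _ Eu) /=; [exact: (integral_arr_sign_refl _ aB aE)|exact: lexx].
have [_ _ nopp _] := rE; have [uE _ _ _] := rE.
have E_neq0 e : e \in E -> e != 0.
  by move=> /E_unit ee; apply: contra_eq_neq ee => ->; rewrite dot0l eq_sym oner_neq0.
(* The direction [u] is chosen so that the line through [v] meets every hyperplane, at pairwise
   distinct times. *)
pose s := E ++ [seq dot ef.1 v *: ef.2 - dot ef.2 v *: ef.1 | ef <-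
     [seq ef <- [seq (e, f) | e <- E, f <- E] | ef.1 != ef.2]].
have [t0 t0P] : exists t : R, {in s, forall a, dot a (\sum_(i < n) t ^+ i *: b i) != 0}.
  apply: exists_generic => a as_; apply: (dot_basis_neq0 b_basis).
  move: as_; rewrite mem_cat => /orP[/E_neq0//|/mapP[[e f]]].
  rewrite mem_filter => /andP[/= ef /allpairsP[[e' f'] /= [eE fE [??]]]] ->.
  subst e' f'; rewrite /= subr_eq0; apply: contraNneq ef => H.
  have fE' : f = (dot f v / dot e v) *: e.
    by rewrite mulrC -scalerA -H scalerA mulVf ?scale1r// Ev.
  have [->//|fe] := unit_proportional (E_unit eE) (E_unit fE) fE'.
  by have := nopp _ eE; rewrite -fe fE.
move: (\sum_(i < n) _) t0P => u uP {t0}.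
have Eu : {in E, forall e, dot e u != 0} by move=> e eE; apply: uP; rewrite mem_cat eE.
pose tt e := - dot e v / dot e u.
have ttinj : {in E &, injective tt}.
  move=> e f eE fE ef; apply/eqP; apply: contraT => neq.
  have : dot (dot e v *: f - dot f v *: e) u != 0.
    apply: uP; rewrite mem_cat; apply/orP; right.
    apply/mapP; exists (e, f) => //; rewrite mem_filter /= neq.
    by apply/allpairsP; exists (e, f).
  have {ef} : dot e v / dot e u = dot f v / dot f u.
    by move: ef; rewrite /tt !mulNr => /oppr_inj.
  rewrite dotBl !dotZl => ef; rewrite subr_eq0 => /eqP; case.
  have -> : dot e v = dot f v / dot f u * dot e u by rewrite -ef divfK// Eu.
  by field; exact: Eu.
have [q qn qP] := pQ v u.
suff q0 : q = 0 by rewrite -[v]addr0 -(scale0r u) qP q0 horner0.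
apply/eqP; apply: contraT => q0.
have roots : all (root q) [seq tt e | e <- E].
  apply/allP => _ /mapP[e eE ->].
  have fix_e : dot e (v + tt e *: u) = 0.
    by rewrite dotDr dotZr /tt; field; exact: Eu.
  (* Antisymmetry is known only off the hyperplanes. It holds at all but finitely many [t], so it is
     an identity between [q] and the polynomial [q'] of the reflected line, valid on the wall as
     well. *)
  have [q' _ q'P] := pQ (refl e v) (refl e u).
  have : q + q' = 0.
    apply/eqP; apply: contraT => qq0.
    have pf0 : \prod_(f <- E) ('X - (tt f)%:P) != 0 :> {poly R}.
      by rewrite monic_neq0// monic_prod_XsubC.
    have [t] := poly_nonroot (mulf_neq0 qq0 pf0).
    rewrite hornerM mulf_eq0 negb_or horner_prod => /andP[/eqP qt].
    rewrite prodf_seq_neq0 => /allP tE; exfalso; apply: qt.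
    rewrite hornerD -qP -q'P -reflZ -reflD Qanti ?subrr//.
    move=> f fE; have := tE f fE; rewrite /= hornerXsubC; apply: contraNneq.
    rewrite dotDr dotZr /tt => H; have fu := Eu _ fE.
    have -> : dot f v = - (t * dot f u) by lra.
    by rewrite opprK mulfK// subrr.
  move=> /(congr1 (fun p : {poly R} => p.[tt e])).
  rewrite hornerD horner0 -qP -q'P -reflZ -reflD refl_orth// /root -qP => H.
  by apply/eqP; lra.
have := max_poly_roots q0 roots; rewrite map_inj_in_uniq// size_map => /(_ uE).
by move=> /leq_trans /(_ qn); rewrite ltnS leqNgt nE.
Qed.
End expansion.
(** * From chambers to the integral of the sign *)

Section chamber_sum.
Variables (R : realType) (V : normedModType R) (dot : {dot V for (@idfun R)}).
Hypothesis norm_dot : forall x : V, `|x| ^+ 2 = dot x x.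
Variables (n : nat) (b : 'I_n -> V).
Hypothesis b_basis : orthonormal_basis dot b.
Local Notation T := (n.-tuple (measurableTypeR R)).
Local Notation mu := (lebesgue_tuple R n).
Local Notation vec := (vec b).

Lemma norm_dot_unit e z : dot e e = 1 -> `|dot e z| <= `|z|.
Proof.
move=> ee; rewrite -(@ler_pXn2r _ 2)// ?nnegrE// norm_dot real_normK ?num_real//.
have := dot_ge0 dot (z - dot e z *: e).
by rewrite !(dotBl, dotBr, dotZl, dotZr) ee (dotC _ z e); lra.
Qed.

Lemma continuous_dot e : dot e e = 1 -> continuous (dot e).
Proof.
move=> ee x; apply/cvgrPdist_lt => eps eps0.
near=> y; rewrite -dotBr; apply: le_lt_trans (norm_dot_unit _ ee) _.
near: y; exact: cvgr_dist_lt.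
Unshelve. all: by end_near. Qed.

Variable E : {fset V}.
Hypothesis E_unit : forall e, e \in E -> dot e e = 1.
Local Notation C0 := (arrangement_complement dot E).

Lemma arrangement_complementP x : C0 x <-> forall e, e \in E -> dot e x != 0.
Proof.
split=> [C0x e eE|Cx [_ [e eE <-]]].
  apply/eqP => ex; apply: C0x; exists (hyperplane dot e) => //.
  by exists e.
by move=> /eqP; apply/negP; exact: Cx.
Qed.

Definition cell x : set V := [set y | forall e, e \in E -> 0 < dot e x * dot e y].

(** On a connected set off the hyperplanes each normal takes an interval of values without 0;
    conversely, the segment between two points with the same signs avoids the hyperplanes. *)
Lemma cell_component x : C0 x -> connected_component C0 x = cell x.
Proof.
move=> /[dup] C0x /arrangement_complementP xE; apply/seteqP; split=> y.
  move=> [C [Cx CC0 cC] Cy] e eE.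
  have /connected_intervalP iC : connected [set dot e z | z in C].
    apply: connected_continuous_connected => //.
    by apply: continuous_subspaceT; exact: (continuous_dot (E_unit eE)).
  have Cnz z : C z -> dot e z != 0 by move=> /CC0/arrangement_complementP; apply.
  have no0 : ~ [set dot e z | z in C] 0.
    by move=> [z Cz ez]; have := Cnz _ Cz; rewrite ez eqxx.
  have fx : [set dot e z | z in C] (dot e x) by exists x.
  have fy : [set dot e z | z in C] (dot e y) by exists y.
  have x0 := Cnz _ Cx; have y0 := Cnz _ Cy.
  rewrite ltNge; apply/negP => xy0; apply: no0.
  have [xp|xn] := ltP 0 (dot e x).
    apply: (iC _ _ fy fx); rewrite (ltW xp) andbT.
    by move: xy0; rewrite pmulr_rle0.
  have {}xn : dot e x < 0 by rewrite lt_neqAle x0.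
  apply: (iC _ _ fx fy); rewrite (ltW xn) /=.
  by move: xy0; rewrite nmulr_rle0.
move=> xy; pose g (t : R) : V := x + t *: (y - x).
have cg : continuous g.
  by move=> t; apply: cvgD; [exact: cvg_cst|apply: cvgZr_tmp; exact: cvg_id].
exists [set g t | t in `[0, 1]%classic]; last first.
  exists 1; first by rewrite /= in_itv /= ler01 lexx.
  by rewrite /g scale1r addrC subrK.
split.
- exists 0; first by rewrite /= in_itv /= lexx ler01.
  by rewrite /g scale0r addr0.
- move=> z [t]; rewrite /= in_itv /= => /andP[t0 t1] <-.
  apply/arrangement_complementP => e eE; have := xy e eE.
  rewrite /g dotDr dotZr dotBr.
  have -> : dot e x + t * (dot e y - dot e x) = (1 - t) * dot e x + t * dot e y by ring.
  have := xE _ eE; move: (dot e x) (dot e y) => u w u0 uw.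
  apply/eqP => H.
  have : 0 < u * ((1 - t) * u + t * w).
    have -> : u * ((1 - t) * u + t * w) = (1 - t) * u ^+ 2 + t * (u * w) by ring.
    have u2 : 0 < u ^+ 2 by rewrite exprn_even_gt0.
    have [t0'|t0'] := eqVneq t 0; first by rewrite t0' subr0 mul1r mul0r addr0.
    have tp : 0 < t by rewrite lt_neqAle eq_sym t0'.
    have t1' : 0 <= 1 - t by rewrite subr_ge0.
    by apply: ltr_wpDl; [apply: mulr_ge0 => //; exact: ltW|exact: mulr_gt0].
  by rewrite H mulr0 ltxx.
- apply: connected_continuous_connected; first exact: segment_connected.
  exact: continuous_subspaceT.
Qed.

Lemma chambersP T' : chambers dot E T' <-> exists2 x, C0 x & T' = cell x.
Proof.
by split=> [[x C0x <-]|[x C0x ->]]; exists x => //; rewrite cell_component.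
Qed.

Lemma cell_refl x : C0 x -> cell x x.
Proof.
move=> /arrangement_complementP xE e /xE ex.
by rewrite -expr2 exprn_even_gt0.
Qed.

Lemma cell_eq x y : cell x y -> cell x = cell y.
Proof.
have pos (u w z : R) : 0 < u * w -> 0 < u * z -> 0 < w * z.
  move=> uw uz; have u2 : 0 < u ^+ 2.
    by rewrite exprn_even_gt0//=; apply: contraTneq uw => ->; rewrite mul0r ltxx.
  have := mulr_gt0 uw uz; have -> : u * w * (u * z) = u ^+ 2 * (w * z) by ring.
  by rewrite pmulr_rgt0.
move=> xy; apply/seteqP; split=> z xz e eE; first exact: pos (xy e eE) (xz e eE).
by apply: pos (xz e eE); rewrite mulrC; exact: xy.
Qed.

Lemma finite_chambers : finite_set (chambers dot E).
Proof.
pose c (s : (size E).-tuple bool) : set V :=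
  [set y | C0 y /\ [seq 0 < dot e y | e <- E] = s].
apply: (@sub_finite_set _ _ [set c s | s in [set: (size E).-tuple bool]]); last first.
  by apply: finite_image; exact: finite_finset.
move=> _ /chambersP[x C0x ->].
exists (map_tuple (fun e => 0 < dot e x) (in_tuple E)) => //.
have /arrangement_complementP xE := C0x.
apply/seteqP; split=> y.
  move=> [/arrangement_complementP yE /= /eq_in_map xy] e eE.
  have := xy e eE; have [ex|ex|ex] := ltgtP 0 (dot e x).
  - by move=> ey; rewrite pmulr_rgt0.
  - move=> /negbT; rewrite -leNgt => ey; rewrite nmulr_rgt0// lt_neqAle ey.
    by rewrite yE.
  - by have := xE _ eE; rewrite -ex eqxx.
move=> xy; split.
  apply/arrangement_complementP => e eE; have := xy e eE.
  by apply: contraTneq => ->; rewrite mulr0 ltxx.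
apply/eq_in_map => e eE; have := xy e eE; have [ex|ex] := ltP 0 (dot e x).
  by rewrite pmulr_rgt0// => ->.
move=> H; apply/negbTE; rewrite -leNgt.
have {}ex : dot e x < 0 by rewrite lt_neqAle ex andbT xE.
by move: H; rewrite nmulr_rgt0// => /ltW.
Qed.

Lemma measurable_cell x : measurable (vec @^-1` cell x).
Proof.
rewrite (_ : _ @^-1` _ = \bigcap_(e in [set` E]) (vec @^-1` [set y | 0 < dot e x * dot e y])).
  apply: fin_bigcap_measurable => [|e _]; first exact: finite_fset.
  have m : measurable_fun [set: T] (fun t => dot e x * dot e (vec t)).
    apply: measurable_funM; first exact: measurable_cst.
    exact: measurable_dot_vec.
  have := @measurable_fun_ltr _ _ R setT (cst 0) _ (measurable_cst _) m
    measurableT [set true] Logic.I.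
  by rewrite setTI.
by apply/seteqP; split.
Qed.

Variables (T0 : set V).
Hypothesis T0_chamber : chambers dot E T0.
Hypothesis T0_pos : forall e x, e \in E -> T0 x -> 0 < dot e x.

(** All normals are positive on [T0], so being opposite to [T0] across [e] means [(e, y) < 0]. *)
Lemma chamber_signE x y : C0 x -> cell x y ->
  chamber_sign dot E T0 (cell x) = arr_sign dot E y.
Proof.
move=> C0x xy.
have /chambersP[z C0z T0E] := T0_chamber.
have T0z : T0 z by rewrite T0E; exact: cell_refl.
have opp e : e \in E -> `[< opposite_sides dot e (cell x) T0 >] = (dot e y < 0).
  move=> eE; apply/asboolP/idP => [/(_ y z xy T0z)|ey].
    by rewrite pmulr_llt0// T0_pos.
  rewrite (cell_eq xy) => y' z' /(_ e eE) yy' /(T0_pos eE) ez'.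
  by rewrite pmulr_llt0//; move: yy'; rewrite nmulr_rgt0.
rewrite /chamber_sign.
have -> : size [fset e in E | `[< opposite_sides dot e (cell x) T0 >]]%fset =
    count (fun e => dot e y < 0) E.
  rewrite -size_filter; apply: perm_size; apply: uniq_perm.
  - exact: fset_uniq.
  - exact: filter_uniq (fset_uniq _).
  - move=> e; rewrite mem_filter !inE /=.
    change ((e \in E) && `[< opposite_sides dot e (cell x) T0 >] = (dot e y < 0) && (e \in E)).
    by have [eE|] := boolP (e \in E); rewrite ?andbF// andbT opp.
have yE e : e \in E -> dot e y != 0.
  by move=> eE; have := xy e eE; apply: contraTneq => ->; rewrite mulr0 ltxx.
rewrite /arr_sign (eq_big_seq (fun e => if dot e y < 0 then -1 else 1)).
  rewrite -big_mkcond big_const_seq /= -Monoid.iteropE.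
  by elim: (count _ _) => //= k; rewrite exprS => ->.
by move=> e /yE; case: sgrP.
Qed.

Lemma pizza_quantityE (K : set V) : measurable (vec @^-1` K) ->
    (mu (vec @^-1` K) < +oo)%E ->
  pizza_quantity dot b E T0 K = (integralV b K (arr_sign dot E))%:E.
Proof.
move=> mK finK; rewrite /pizza_quantity fsbig_finite; last exact: finite_chambers.
(* The default makes the function tame for every index, as [integralV_sum] asks. *)
pose ind (T' : set V) : V -> R := if `[< chambers dot E T' >] then \1_T' else \1_set0.
have tind T' : tame b (ind T').
  rewrite /ind; case: asboolP => [/chambersP[x _ ->]|_]; apply: tame_indicator.
    exact: measurable_cell.
  by rewrite preimage_set0.
have tind' T' : tame b (fun y => chamber_sign dot E T0 T' * ind T' y).
  by apply: tameM => //; exact: tame_cst.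
transitivity (\sum_(T' <- fset_set (chambers dot E))
    integralV b K (fun y => chamber_sign dot E T0 T' * ind T' y))%:E.
  rewrite -sumEFin; apply: eq_big_seq => T'.
  rewrite (in_fset_set finite_chambers) inE.
  move=> cT; rewrite (integralVZ mK finK)// EFinM; congr (_ * _)%E.
  rewrite /integralV /Rintegral.
  have /chambersP[x C0x T'E] := cT.
  have mT : measurable (vec @^-1` T') by rewrite T'E; exact: measurable_cell.
  rewrite (eq_integral (fun t => (\1_(vec @^-1` T') t)%:E)); last first.
    by move=> t _; rewrite /ind asboolT.
  rewrite integral_indic// setIC -preimage_setI fineK//.
  rewrite ge0_fin_numE//; apply: le_lt_trans finK.
  by apply: le_measure; rewrite ?inE//; exact: measurableI.
rewrite -(integralV_sum mK finK)//; congr EFin; apply: eq_Rintegral => t _.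
(* The integrands agree at every point: on a hyperplane both vanish, and elsewhere only the cell of
   the point contributes. *)
have [C0t|C0t] := pselect (C0 (vec t)); last first.
  have [e eE et] : exists2 e, e \in E & dot e (vec t) = 0.
    apply: contrapT => H; apply: C0t; apply/arrangement_complementP => e eE.
    by apply/eqP => et; apply: H; exists e.
  rewrite [RHS]/arr_sign (big_rem e)//= et sgr0 mul0r big1_seq// => T' /=.
  rewrite (in_fset_set finite_chambers) inE.
  move=> cT; rewrite /ind asboolT// indicE memNset ?mulr0//.
  have /chambersP[x C0x ->] := cT; move=> /(_ e eE).
  by rewrite et mulr0 ltxx.
have ct : chambers dot E (cell (vec t)) by apply/chambersP; exists (vec t).
rewrite (bigD1_seq (cell (vec t))) ?fset_uniq//=; last first.
  by rewrite (in_fset_set finite_chambers) inE.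
rewrite big1_seq ?addr0.
  rewrite /ind asboolT// indicE mem_set ?mulr1; last exact: cell_refl.
  by apply: chamber_signE => //; exact: cell_refl.
move=> T' /andP[T't]; rewrite (in_fset_set finite_chambers) inE.
move=> cT; rewrite /ind asboolT// indicE memNset ?mulr0//.
have /chambersP[x C0x T'E] := cT; rewrite T'E => /cell_eq xt.
by rewrite T'E xt eqxx in T't.
Qed.

Lemma integralV_translate (K : set V) v (f : V -> R) : measurable (vec @^-1` K) ->
    (mu (vec @^-1` K) < +oo)%E -> tame b f ->
  integralV b K f = integralV b [set x | K (x + v)] (fun x => f (x + v)).
Proof.
move=> mK finK tf; rewrite /integralV /Rintegral; congr fine.
pose h : T -> T := tuple_affine (fun=> 1) (tnth (crd dot b v)).
have mh : measurable_fun [set: T] h by exact: measurable_tuple_affine.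
have hE t : vec (h t) = vec t + v by exact: vec_translate.
have [mf _] := tf.
have pK : h @^-1` (vec @^-1` K) = vec @^-1` [set x | K (x + v)].
  by apply/seteqP; split=> t; rewrite /preimage /= hE.
have mK' : measurable (vec @^-1` [set x | K (x + v)]).
  by rewrite -pK -[X in measurable X]setTI; exact: mh.
have tf' : tame b (fun x => f (x + v)).
  split; last by have [_ [M fM]] := tf; exists M => x; exact: fM.
  rewrite (_ : (fun t => _) = (fun t => f (vec t)) \o h); first exact: (measurableT_comp mf).
  by apply/funext => t /=; rewrite hE.
transitivity (\int[pushforward mu h]_(t in vec @^-1` K) (f (vec t))%:E)%E; last first.
  rewrite (integral_pushforward mh)//; last 2 first.
  - exact/measurable_EFinP.
  - rewrite pK (_ : _ \o _ = EFin \o (fun t => f (vec t + v))).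
      apply: (@tame_integrable _ _ _ _ _ mK' _ (fun x => f (x + v))) => //.
      by rewrite (volume_translate b_basis).
    by apply/funext => t /=; rewrite hE.
  by rewrite pK; apply: eq_integral => t _ /=; rewrite hE.
apply: eq_measure_integral => A mA _; rewrite /pushforward.
rewrite -[LHS](lebesgue_tuple_affine (k := fun=> 1) (tnth (crd dot b v)))//.
by rewrite big1 ?mul1e// => i _; rewrite normr1.
Qed.
End chamber_sum.

(** * Normals of a Coxeter arrangement as a root system *)

Section coxeter_roots.
Variables (R : realType) (V : normedModType R) (dot : {dot V for (@idfun R)}).
Local Notation refl := (reflection dot).

(** The vector [f - (e, f) e] lies in the hyperplane of [e], hence in that of [f]. This gives
    [(e, f)^2 = 1], so its square norm [1 - (e, f)^2] vanishes. *)
Lemma hyperplane_inj e f : dot e e = 1 -> dot f f = 1 ->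
  hyperplane dot e = hyperplane dot f -> f = e \/ f = - e.
Proof.
move=> ee ff ef; apply: (unit_proportional (k := dot e f) ee ff).
have : hyperplane dot f (f - dot e f *: e).
  by rewrite -ef /hyperplane /= dotBr dotZr ee mulr1 subrr.
rewrite /hyperplane /= dotBr dotZr ff (dotC _ f) => H.
apply/eqP; rewrite -subr_eq0; apply/eqP/(dot_eq0 (dot := dot)).
by rewrite !(dotBl, dotBr, dotZl, dotZr) ee ff (dotC _ f); lra.
Qed.

Lemma coxeter_root_seq (E : {fset V}) (T0 : set V) :
  is_arrangement dot E T0 -> is_coxeter dot E -> root_seq dot E.
Proof.
move=> [Eu Ed _ _] [_ Ec]; split => //.
- exact: fset_uniq.
- move=> e eE; apply/negP => neE.
  have eNe : e != - e.
    apply/eqP => H; have := Eu _ eE.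
    by rewrite {1}H dotNl Eu// => ?; clear H; lra.
  apply: (Ed _ _ eE neE eNe); exists 1, 1; split.
    by move=> [/eqP]; rewrite oner_eq0.
  by rewrite !scale1r subrr.
- move=> a c aE cE.
  have : (arrangement dot E) (refl a @` hyperplane dot c).
    by rewrite -(Ec _ aE); exists (hyperplane dot c) => //; exists c.
  move=> [f fE fH].
  have ua := Eu _ aE.
  have : hyperplane dot (refl a c) = hyperplane dot f.
    rewrite fH; apply/seteqP; split=> x.
      rewrite /hyperplane /= -dot_refl_swap => cx.
      by exists (refl a x) => //; rewrite reflK.
    by move=> [y cy <-]; rewrite /hyperplane /= refl_isom.
  move=> /hyperplane_inj [||<-|]; [by rewrite refl_isom// Eu|exact: Eu|by left|].
  by move=> fE'; right; rewrite -fE'.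
Qed.

(** Words form a transformation group containing the reflections, inverses being reversed words. *)
Lemma coxeter_group_word (E : {fset V}) w : (forall e, e \in E -> dot e e = 1) ->
  coxeter_group dot E w -> exists2 l, {subset l <= E} & w =1 refl_word dot l.
Proof.
move=> Eu; pose M := [set w : V -> V | exists2 l : seq V, {subset l <= E} & w =1 refl_word dot l].
suff : coxeter_group dot E `<=` M by exact.
apply: smallest_sub.
  split; first by exists [::].
    move=> g h [l lE gl] [l' l'E hl']; exists (l ++ l').
      by move=> x; rewrite mem_cat => /orP[/lE|/l'E].
    by move=> x /=; rewrite gl hl' refl_word_cat.
  move=> g h [l lE gl] gK hK; exists (rev l); first by move=> x; rewrite mem_rev => /lE.
  have lu : {in l, forall a, dot a a = 1} by move=> a /lE; exact: Eu.
  by move=> x; rewrite -{2}(hK x) gl refl_word_rev.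
by move=> _ [e eE <-]; exists [:: e] => // x; rewrite inE => /eqP ->.
Qed.

End coxeter_roots.

(** * Vanishing of [P(H, K)] for a translate of an invariant set *)

Unset Implicit Arguments.

Theorem theorem1p2 (R : realType) (V : normedModType R)
    (dot : {dot V for (@idfun R)})
    (norm_dot : forall x : V, `|x| ^+ 2 = dot x x)
    (n : nat) (b : 'I_n -> V) (b_basis : orthonormal_basis dot b)
    (E : {fset V}) (T0 : set V) (E_arr : is_arrangement dot E T0)
    (E_coxeter : is_coxeter dot E)
    (E_opp : coxeter_group dot E (fun x => - x))
    (E_not_A1n : ~ type_A1n dot n E)
    (K : set V) (K_compact : compact K) (K_convex : convex_set K) (K_0 : K 0)
    (L : set V) (v : V)
    (L_inv : forall w, coxeter_group dot E w -> w @` L = L)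
    (K_L : K = [set x + v | x in L]) :
  pizza_quantity dot b E T0 K = 0%E.
Proof.
have rE := coxeter_root_seq E_arr E_coxeter.
have [Eu _ T0c T0p] := E_arr.
have [uE Eu' _ Ec] := rE.
have EN : exists2 l, {subset l <= E} & forall x, refl_word dot l x = - x.
  by have [l lE lN] := coxeter_group_word Eu E_opp; exists l.
have Eext s : {subset s <= E} -> orthogonal_seq dot s -> (size s < n)%N ->
    exists2 e, e \in (E : seq V) & {in s, forall a, dot a e = 0}.
  by move=> sE os sn; exact: (orthogonal_extension b_basis Eu' Ec EN sE os sn).
(* There are [n] orthogonal roots; if they were all the roots, the type would be [A_1^n]. *)
have nE : (n < size (E : seq V))%N.
  have os0 : orthogonal_seq dot [::] by split.
  have [//|s [sE [us os] sn]] := orthogonal_completion b_basis Eu' Ec EN _ os0 (leq0n n).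
  have nE : (n <= size (E : seq V))%N by rewrite -sn; exact: uniq_leq_size.
  rewrite ltn_neqAle nE andbT; apply/eqP => En; apply: E_not_A1n; split=> // e f eE fE ef.
  have Es : (size (E : seq V) <= size s)%N by rewrite sn En.
  have [_ sEi] := uniq_min_size us sE Es.
  by apply: os => //; rewrite sEi.
have KE x : K (x + v) <-> L x.
  rewrite K_L; split=> [[y Ly /addIr <-]//|Lx]; by exists x.
have LE : L = [set x | K (x + v)] by apply/seteqP; split=> x /=; rewrite KE.
have mK : measurable (vec b @^-1` K).
  apply: (measurable_vec_closed norm_dot b_basis).
  by apply: compact_closed => //; exact: norm_hausdorff.
have finK : (lebesgue_tuple R n (vec b @^-1` K) < +oo)%E.
  have [M [_ KM]] := compact_bounded K_compact.
  apply: (volume_bounded_fin norm_dot b_basis mK (r := M + 1)) => x Kx.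
  by apply: (KM (M + 1)) => //; rewrite ltrDl.
have mL : measurable (vec b @^-1` L).
  rewrite LE (_ : _ @^-1` _ = tuple_affine (fun=> 1) (tnth (crd dot b v)) @^-1` (vec b @^-1` K)).
    by rewrite -[X in measurable X]setTI; exact: measurable_tuple_affine.
  by apply/seteqP; split=> t; rewrite /preimage /= vec_translate.
have L_adm : admissible dot b (E : seq V) L.
  split=> //.
  - by rewrite LE (volume_translate b_basis).
  - move=> x y t /KE Kx /KE Ky /andP[t0 t1]; apply/KE.
    have := K_convex (y + v) (x + v) (Itv01 t0 t1) (mem_set Ky) (mem_set Kx).
    rewrite inE /conv /=; congr K; apply: (@dot_inj _ _ dot) => z.
    by rewrite /unstable.onem !(dotDr, dotZr); ring.
  - move=> e x eE Lx; rewrite -(L_inv (reflection dot e)); first by exists x.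
    by apply: sub_gen_smallest; exists e.
(* As 0 is in [K], the vector [- v] is in [L], and -1 belongs to the group. *)
have Lv : L v.
  have LNv : L (- v) by apply/KE; rewrite addNr.
  by rewrite -(L_inv _ E_opp); exists (- v) => //; rewrite opprK.
rewrite (pizza_quantityE norm_dot Eu T0c T0p mK finK).
have ts : tame b (arr_sign dot E).
  by apply: (@tame_arr_sign _ _ dot _ b _ id) => e; exact: measurable_dot_vec.
rewrite (integralV_translate b_basis v mK finK ts) -LE.
by rewrite (integral_arr_sign_eq0 b_basis rE Eext norm_dot nE L_adm Lv).
Qed.
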